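(* There exists a function $f:\mathbb{N}\to\mathbb{N}$ such that the following holds. Let $m$ be a positive integer, let $p$ be a prime, and let $G$ be a pro-$p$ group such that there are $m$ procyclic subgroups of $G$ whose union contains all commutators $[x,y]$ with $x,y\in G$. Then either $G'$ is finite with $|G'|\le f(m)$, or $G'$ is procyclic. (The function $f$ does not depend on $p$ or $G$.)
   Context: For profinite groups (in particular pro-$p$ groups) all the usual group-theoretic concepts are interpreted topologically: subgroups are closed, and $G'$ denotes the closed subgroup of $G$ generated by all commutators $[x,y]$, $x,y\in G$. A procyclic group is a profinite group that is topologically generated by one element (equivalently, an inverse limit of finite cyclic groups). *)

(* Defs.v *)
From HB Require Import structures.
From mathcomp Require Import all_boot.
From mathcomp Require Import boolp classical_sets functions cardinality.
From mathcomp Require Import topology.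

Set Implicit Arguments.
Unset Strict Implicit.
Unset Printing Implicit Defensive.

Local Open Scope classical_set_scope.
Local Open Scope card_scope.
Local Open Scope group_scope.

HB.mixin Record isTopologicalGroup G & Topological G & Group G := {
  mulg_continuous : continuous (fun x : G * G => x.1 * x.2) ;
  invg_continuous : continuous (fun x : G => x^-1)
}.

#[short(type="topologicalGroupType")]
HB.structure Definition TopologicalGroup :=
  {G of Topological G & Group G & isTopologicalGroup G}.

Section ProfiniteGroups.
Context {G : topologicalGroupType}.
Implicit Types (A H N : set G) (x y : G).

Definition normal_subgroup N := group_closed [in N] /\
  forall x y, N y -> N (y ^ x).

Definition lcosets_of N : set (set G) :=
  [set [set x * y | y in N] | x in [set: G]].

Definition closed_subgroup H := group_closed [in H] /\ closed H.

(* [closed_subgroup] is stable under intersections, so this is the smallest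
   closed subgroup containing A. *)
Definition closed_gen A : set G := smallest closed_subgroup A.

Definition procyclic_subgroup H := exists x, H = closed_gen [set x].

Definition derived_subgroup : set G :=
  closed_gen [set g | exists x y, g = [~ x, y]].

End ProfiniteGroups.

Definition profinite (G : topologicalGroupType) :=
  [/\ compact [set: G], hausdorff_space G & totally_disconnected [set: G]].

Definition pro_p (p : nat) (G : topologicalGroupType) := profinite G /\
  forall N : set G, normal_subgroup N -> open N ->
    exists k : nat, lcosets_of N #= `I_(expn p k).

Arguments derived_subgroup G : clear implicits.

(* Main.v *)
(* Finite quotients suffice.  If some finite quotient of G has a noncyclic
   derived group, so do all larger ones, and a uniform bound on the orders of
   these derived groups bounds |G'|.  Otherwise an element of G' with nontrivial
   image generating the derived group of one quotient generates it in every
   larger quotient, so G' is procyclic.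

   Let G be a finite p-group with H = G' noncyclic; among any m + 1 commutators
   one is a power of another.  If H is abelian, this principle is applied to two
   kinds of sections.  When H has exponent p^k and all elements of exponent
   p^(k-1) die in a noncyclic quotient of H of order p^2, the commutators
   [x^(p^j) g, y] force k <= 2m, so H^(p^(2m)) is cyclic.  When H has a central
   subgroup of order p with cyclic quotient of order p^k, the commutators
   [g x^n, y] force k <= m + 1; moreover p <= m.  Hence H has bounded exponent.

   In general this bounds the exponent of H / H'.  The elements normalising all
   cyclic groups generated by commutators form a subgroup G0 of index at most m^m
   whose derived group centralises H.  For D = (H :&: G0)' the group
   (H :&: G0) / D is abelian and normal, and comparing the commutators
   [x a, y] = c theta(a) for c = [x, y] and a in it bounds the exponent of H / D,
   hence its order by Dietzmann's lemma.  As D is central in H, Schur's theorem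
   (via the transfer) bounds the exponent and then the order of H. *)

Require Import Defs.
From HB Require Import structures.
From mathcomp Require Import all_boot all_algebra all_fingroup all_solvable.
From mathcomp Require Import ring.

Set Implicit Arguments.
Unset Strict Implicit.
Unset Printing Implicit Defensive.

(** * Sums of powers modulo a prime power *)

(** When one of two pigeonholed commutators is the [r]-th power of the other, one independent
    component forces r to be prime to p, and the remaining components must then have equal p-adic
    valuations. Families whose exponents are [p ^ j] for distinct j violate this. In [m + m], one m
    pays for making an element act almost trivially on H, the other for the pigeonhole. The main
    obstacle is p = 2: an action on a cyclic group by an exponent 3 modulo 4 has sums of powers that
    miss residues, so other commutators must replace them. The inequality [p <= m] turns powers of p
    into bounds in m alone. The factorial arises because a group of order at most m has exponent
    dividing m!. Dividing by the derived group of [H :&: G0] supplies an abelian subgroup that is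
    normal in G and of bounded index in H, the setting in which the identities for [c theta(a)]
    apply. *)

Definition geom_sum (l n : nat) := \sum_(i < n) l ^ i.

Lemma geom_sumS l n : geom_sum l n.+1 = geom_sum l n + l ^ n.
Proof. exact: big_ord_recr. Qed.

Lemma geom_sumD l a b : geom_sum l (a + b) = geom_sum l a + l ^ a * geom_sum l b.
Proof.
elim: b => [|b IH]; first by rewrite addn0 /geom_sum big_ord0 muln0 addn0.
by rewrite addnS !geom_sumS IH expnD mulnDr addnA.
Qed.

Lemma geom_sumM l a b : geom_sum l (a * b) = geom_sum l a * geom_sum (l ^ a) b.
Proof.
elim: b => [|b IH]; first by rewrite muln0 /geom_sum !big_ord0 muln0.
by rewrite mulnSr geom_sumD IH geom_sumS mulnDr -expnM; congr (_ + _); rewrite mulnC.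
Qed.

Lemma geom_sum_mod q z n : geom_sum (1 + q * z) n = n %[mod q].
Proof.
elim: n => [|n IH]; first by rewrite /geom_sum big_ord0.
rewrite geom_sumS -modnDml IH modnDml -modnDmr.
have -> : (1 + q * z) ^ n = 1 %[mod q].
  by rewrite -modnXm addnC mulnC modnMDl modnXm exp1n.
by rewrite modnDmr addn1.
Qed.

(** Lifting the exponent: for [n = p * n'] the sum factors into the sum of p powers of [l], which is
    p times a unit, and a sum of [n'] powers of [l ^ p]. For p = 2 the first factor is twice a unit
    only if [l] is 1 modulo 4. *)
Lemma geom_sum_dvd p z j n : prime p -> (p = 2 -> 2 %| z) ->
  p ^ j %| geom_sum (1 + p * z) n -> p ^ j %| n.
Proof.
move=> p_pr; elim: j z n => [|j IH] z n p2 dv; first by rewrite dvd1n.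
have p_gt0 := prime_gt0 p_pr.
have /dvdnP[n' en] : p %| n.
  have : p %| geom_sum (1 + p * z) n by apply: dvdn_trans dv; rewrite expnS dvdn_mulr.
  by rewrite /dvdn geom_sum_mod.
have [u eu npu] : exists2 u, geom_sum (1 + p * z) p = p * u & ~~ (p %| u).
  (* Expansion modulo [p ^ 2]; at [n0 = p] odd, the binomial coefficient gives the middle term a
     second factor p. *)
  have H n0 : exists q, geom_sum (1 + p * z) n0 = n0 + p * z * 'C(n0, 2) + p ^ 2 * q.
    elim: n0 => [|n0 [q IHn]]; first by exists 0; rewrite /geom_sum big_ord0 bin0n !muln0.
    have [r er] : exists r, (1 + p * z) ^ n0 = 1 + n0 * (p * z) + p ^ 2 * r.
      elim: n0 {IHn} => [|n1 [r er]]; first by exists 0; rewrite muln0.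
      exists (n1 * z * z + r * (1 + p * z)); rewrite expnS er; ring.
    exists (q + r); rewrite geom_sumS IHn er binS bin1; ring.
  have [q eq] := H p; have [podd | [p2' ]] : odd p \/ p = 2.
      by case: (even_prime p_pr) => [->|]; [right | left].
    have /dvdnP[b eb] : p %| 'C(p, 2).
      by apply: prime_dvd_bin => //; have := prime_gt1 p_pr; case: (p) podd => [|[|[|]]].
    exists (1 + p * (z * b + q)); first by rewrite eq eb; ring.
    by rewrite dvdn_addl ?dvdn_mulr // dvdn1; have := prime_gt1 p_pr; case: (p) => [|[]].
  have /dvdnP[z' ez] := p2 p2'; subst p.
  exists (1 + 2 * z'); first by rewrite /geom_sum !big_ord_recl big_ord0 /= ez; ring.
  by rewrite dvdn_addl ?dvdn_mulr.
have [z' ez' p2'] : exists2 z', (1 + p * z) ^ p = 1 + p * z' & p = 2 -> 2 %| z'.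
  suff [z' ez' zz'] : exists2 z', (1 + p * z) ^ p = 1 + p * z' & z %| z'.
    by exists z' => // /p2 dz; apply: dvdn_trans zz'.
  elim: (X in _ ^ X) => [|n0 [z1 e1 /dvdnP[w ew]]]; first by exists 0; rewrite ?muln0.
  exists (z1 + z + p * z * z1); first by rewrite expnS e1; ring.
  by rewrite ew !dvdn_add ?dvdn_mull ?dvdn_mulr.
move: dv; rewrite en (mulnC n') geom_sumM eu ez' expnS -mulnA dvdn_pmul2l //.
rewrite Gauss_dvdr; last by rewrite coprimeXl // prime_coprime.
by move/(IH _ _ p2') => dv; rewrite dvdn_pmul2l.
Qed.

(** These are the exponents of c in the commutators [[~ g * x ^+ n, y]] when x acts on [<[c]>] as
    the power [1 + p * z]. Two values differ by a unit times a sum of [b - a] powers, so the map is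
    injective on residues modulo [p ^ k], hence onto. *)
Lemma affine_orbit_onto p k z i e : prime p -> (p = 2 -> 2 %| z) ->
  exists n, i * (1 + p * z) ^ n + geom_sum (1 + p * z) n = e %[mod p ^ k].
Proof.
move=> p_pr p2; set l := 1 + p * z.
have q0 : 0 < p ^ k by rewrite expn_gt0 prime_gt0.
pose f (n : 'I_(p ^ k)) : 'I_(p ^ k) :=
  Ordinal (ltn_pmod (i * l ^ n + geom_sum l n) q0).
have cop n : coprime (p ^ k) (l ^ n).
  rewrite coprimeXl // coprimeXr //.
  by rewrite /l addnC prime_coprime // dvdn_addr ?dvdn_mulr // dvdn1; case: (p) p_pr => [|[]].
have inj_lt (a b : 'I_(p ^ k)) : a < b -> f a <> f b.
  move=> ltab /(congr1 val) /= e1.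
  have eb : val b = a + (b - a) by rewrite subnKC // ltnW.
  move: e1; rewrite [in RHS]eb geom_sumD expnD.
  have -> : i * (l ^ a * l ^ (b - a)) + (geom_sum l a + l ^ a * geom_sum l (b - a))
     = i * l ^ a + geom_sum l a + l ^ a * (geom_sum l (b - a) * (1 + i * (p * z))).
    have -> : l ^ (b - a) = 1 + (p * z) * geom_sum l (b - a).
      elim: (b - a) => [|n IH]; first by rewrite /geom_sum big_ord0 muln0.
      by rewrite expnS {1}/l geom_sumS mulnDr mulnDl mul1n {1}IH addnA.
    ring.
  move/eqP; rewrite -{1}[_ + geom_sum l a]addn0 eqn_modDl mod0n eq_sym -/(_ %| _).
  rewrite Gauss_dvdr // mulnC Gauss_dvdr; last first.
    rewrite coprimeXl // addnC prime_coprime // dvdn_addr ?dvdn1; last exact: dvdn_mull (dvdn_mulr _ (dvdnn _)).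
    by case: (p) p_pr => [|[]].
  move/(geom_sum_dvd p_pr p2) => dv; have := dvdn_leq _ dv; rewrite subn_gt0 ltab => /(_ isT).
  by apply/negP; rewrite -ltnNge; apply: leq_ltn_trans (leq_subr _ _) (ltn_ord b).
have injf : injective f.
  by move=> a b e1; case: (ltngtP a b) => [lt|lt|/val_inj //]; case: (inj_lt _ _ lt).
have /codomP[n en] := inj_card_onto injf (leqnn _) (Ordinal (ltn_pmod e q0)).
by exists n; have := congr1 val en => /= ->.
Qed.

Local Open Scope group_scope.

(** * Coverings of commutators in finite p-groups *)

Definition comm_cover (m : nat) (gT : finGroupType) (G : {set gT}) :=
  exists s : 'I_m -> gT,
    forall x y, x \in G -> y \in G -> exists i, [~ x, y] \in <[s i]>.

Section Cover.
Variables (gT : finGroupType) (p m : nat).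
Implicit Types (G H N : {group gT}) (x y c d : gT).

Lemma p_elt_cyclic_chain (C : {group gT}) x y :
    prime p -> cyclic C -> x \in C -> y \in C -> p.-elt x -> p.-elt y ->
  x \in <[y]> \/ y \in <[x]>.
Proof.
move=> p_pr cC xC yC /p_natP[a oa] /p_natP[b ob].
case: (leqP a b) => [le_ab | /ltnW le_ba]; [left | right].
  by rewrite -cycle_subG -(cardSg_cyclic cC) ?cycle_subG // -!orderE oa ob dvdn_exp2l.
by rewrite -cycle_subG -(cardSg_cyclic cC) ?cycle_subG // -!orderE oa ob dvdn_exp2l.
Qed.

(** Cutting each cyclic subgroup down to G puts its generator in the normaliser of N, so that the
    cover has an image in [G / N]. *)
Lemma comm_cover_in G :
    comm_cover m G ->
  exists2 s : 'I_m -> gT, forall i, s i \in G &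
    forall x y, x \in G -> y \in G -> exists i, [~ x, y] \in <[s i]>.
Proof.
case=> s sP.
have [i|t tP] := fin_all_exists (_ : forall i, exists z, <[s i]> :&: G = <[z]>).
  by apply/cyclicP; apply: cyclicS (subsetIl _ _) (cycle_cyclic _).
exists t => [i | x y Gx Gy]; first by have := cycle_id (t i); rewrite -tP => /setIP[].
by have [i si] := sP _ _ Gx Gy; exists i; rewrite -tP inE si groupR.
Qed.

Lemma comm_cover_quotient G N :
  G \subset 'N(N) -> comm_cover m G -> comm_cover m (G / N).
Proof.
move=> nNG /comm_cover_in[s sG sP]; exists (fun i => coset N (s i)) => u v.
case/morphimP=> x Nx Gx -> /morphimP[y Ny Gy ->].
have [i si] := sP x y Gx Gy; exists i.
have sN : s i \in 'N(N) by apply: subsetP (sG i).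
by rewrite -morphR // -quotient_cycle // mem_quotient.
Qed.

(* [m + 1] commutators cannot all lie in different cyclic subgroups of the
   cover, and the subgroups of a cyclic p-group form a chain. *)
Lemma comm_cover_pigeon G (f : nat -> gT) :
    prime p -> p.-group G -> comm_cover m G ->
    (forall i, i <= m ->
       exists x y, [/\ x \in G, y \in G & f i = [~ x, y]]) ->
  exists i j, i < j <= m /\ (f i \in <[f j]> \/ f j \in <[f i]>).
Proof.
move=> p_pr pG [s sP] fP.
have [i|h hP] := fin_all_exists (_ : forall i : 'I_m.+1, exists k, f i \in <[s k]>).
  have [|x [y [Gx Gy ->]]] := fP i; first by rewrite -ltnS.
  exact: sP.
have /injectivePn[i [j nij ehij]] : ~~ injectiveb h.
  by apply/injectiveP => /leq_card; rewrite !card_ord ltnn.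
have pf (k : 'I_m.+1) : p.-elt (f k).
  have [|x [y [Gx Gy ->]]] := fP k; first by rewrite -ltnS.
  by apply: mem_p_elt pG _; rewrite groupR.
have sub : f i \in <[f j]> \/ f j \in <[f i]>.
  apply: (p_elt_cyclic_chain p_pr (cycle_cyclic (s (h i)))) => //.
  by rewrite ehij.
have := ltn_ord i; have := ltn_ord j; rewrite !ltnS => lej lei.
case: (ltngtP i j) => [ltij | ltji | /val_inj eqij].
- by exists i, j; rewrite ltij.
- by exists j, i; rewrite ltji; split=> //; case: sub; [right|left].
by rewrite eqij eqxx in nij.
Qed.

End Cover.

(** N is maximal among the normal subgroups between W and S over which H stays noncyclic. Since
    [H / S] is cyclic, [S / N] is nontrivial and contains a central subgroup of order p; by
    maximality, dividing it out makes H cyclic. The uses are S = H and W = 1. *)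
Lemma noncyclic_normal_quotient (gT : finGroupType) p (G H W S : {group gT}) :
    prime p -> p.-group G -> H <| G -> W <| G -> S <| G ->
    W \subset S -> S \subset H -> ~~ cyclic (H / W) -> cyclic (H / S) ->
  exists N : {group gT}, [/\ N <| G, W \subset N, N \subset S, ~~ cyclic (H / N) &
    exists Z : {group coset_of N}, [/\ Z \subset S / N, Z \subset 'Z(G / N),
      #|Z| = p & cyclic (H / N / Z)]].
Proof.
move=> p_pr pG nsHG nsWG nsSG sWS sSH ncHW cHS.
pose P (N : {group gT}) := [&& N <| G, N \subset S & ~~ cyclic (H / N)].
have PW : P W by rewrite /P nsWG sWS.
have [N /maxgroupP[/and3P[nsNG sNS ncHN] maxN] sWN] := maxgroup_exists PW.
exists N; split=> //.
have ntSN : S / N != 1.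
  apply: contraNneq ncHN => /trivgP; rewrite quotient_sub1; last first.
    exact: subset_trans (normal_sub nsSG) (normal_norm nsNG).
  move=> sSN; have eNS : N = S by apply/group_inj/eqP; rewrite eqEsubset sNS.
  by rewrite eNS.
have pGN : p.-group (G / N) by apply: quotient_pgroup.
have nsSNG : S / N <| G / N by apply: quotient_normal.
have ntSZ := meet_center_nil (pgroup_nil pGN) nsSNG ntSN.
have pSZ : p.-group (S / N :&: 'Z(G / N)).
  by apply: pgroupS pGN; rewrite subIset // normal_sub.
have [_ pdvd _] := pgroup_pdiv pSZ ntSZ.
have [x /setIP[Sx Zx] ox] := Cauchy p_pr pdvd.
exists <[x]>%G; rewrite !cycle_subG; split=> //.
set Z := <[x]>%G.
have nsZ : Z <| G / N.
  rewrite /normal !cycle_subG (subsetP (center_sub _) _ Zx) cents_norm // centsC cycle_subG.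
  by case/setIP: Zx.
pose N2 := (coset N @*^-1 Z)%G.
have nsN2 : N2 <| G.
  by rewrite -(quotientGK nsNG) cosetpre_normal.
have sNN2 : N \subset N2 by apply: sub_cosetpre.
have sN2S : N2 \subset S.
  rewrite -(quotientGK (normalS sNS (normal_sub nsSG) nsNG)).
  by rewrite cosetpreSK cycle_subG.
have sNH := subset_trans sNS sSH; have sN2H := subset_trans sN2S sSH.
have N2N : N2 / N = Z by rewrite cosetpreK.
have cH2 : cyclic (H / N2).
  apply: contraTT isT => ncH2; have := maxN N2 _ sNN2.
  rewrite /P nsN2 sN2S ncH2 => /(_ isT) eN.
  have: Z :=: 1 by rewrite -N2N eN trivg_quotient.
  by move/eqP; rewrite trivg_card1 -orderE ox; case: (p) p_pr => [|[]].
rewrite -[in cyclic _]N2N.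
by rewrite (isog_cyclic (third_isog sNN2 _ _)) ?(normalS _ (normal_sub nsHG)).
Qed.

Lemma order_p_expg_eq1 (gT : finGroupType) p (c : gT) i :
  prime p -> c != 1 -> c ^+ p = 1 -> c ^+ i = 1 -> p %| i.
Proof.
move=> p_pr nt cp ci; have oc : #[c] = p.
  by apply: nt_prime_order.
by rewrite -oc order_dvdn ci.
Qed.

(** * Derived groups with a noncyclic quotient of order p^2 *)

Section OrderP2.
Variables (gT : finGroupType) (p : nat) (G : {group gT}).
Hypotheses (p_pr : prime p) (pG : p.-group G).
Hypotheses (oH : #|G^`(1)| = (p ^ 2)%N) (ncH : ~~ cyclic G^`(1)).

Let H := G^`(1)%G.
Let sHG : H \subset G. Proof. exact: der_sub. Qed.

Lemma der1_p2_expp c : c \in G^`(1) -> c ^+ p = 1.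
Proof.
move=> Hc; have pH : p.-group H by apply: pgroupS pG.
have : #[c] %| p ^ 2 by rewrite -oH order_dvdG.
case/(dvdn_pfactor _ _ p_pr)=> k lek2 oc.
have : (k < 2)%N.
  rewrite ltn_neqAle lek2 andbT; apply: contraNneq ncH => k2.
  by apply/cyclicP; exists c; apply/esym/eqP; rewrite eqEcard cycle_subG Hc -orderE oc oH k2 leqnn.
move=> ltk; apply/eqP; rewrite -order_dvdn oc.
by apply: (@dvdn_exp2l p k 1).
Qed.

Lemma der1_p2_indep c d i j : c \in G^`(1) -> d \in G^`(1) ->
  c != 1 -> d \notin <[c]> -> c ^+ i * d ^+ j = 1 -> (p %| i) && (p %| j).
Proof.
move=> Hc Hd nt ndc e.
have cp := der1_p2_expp Hc; have dp := der1_p2_expp Hd.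
have dj : d ^+ j \in <[c]>.
  have -> : d ^+ j = (c ^+ i)^-1 by apply/eqP; rewrite eq_sym eq_invg_mul e.
  by rewrite groupV mem_cycle.
have pj : p %| j.
  apply: contraNT (ndc) => npj; have copj : coprime p j by rewrite prime_coprime.
  have od : #[d] = p.
    by apply: nt_prime_order => //; apply: contraNneq ndc => ->; apply: group1.
  have := generator_coprime d j; rewrite od copj => /eqP gd; rewrite -cycle_subG gd.
  by rewrite cycle_subG.
rewrite pj andbT; apply: (order_p_expg_eq1 p_pr nt cp).
by move: e; case/dvdnP: pj => k ->; rewrite mulnC expgM dp expg1n mulg1.
Qed.

(** Both alternatives produce two independent commutators with a common second entry. *)
Lemma der1_p2_dichotomy :
  (H \subset 'Z(G) /\ exists x y g, [/\ x \in G, y \in G, g \in G,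
      [~ x, y] != 1 & [~ g, y] \notin <[[~ x, y]]>])
  \/ ([~: H, G] \subset H /\ exists x v e, [/\ x \in G, v \in G, e \in H,
      [~ x, v] \notin [~: H, G] & [~ e, v] != 1]).
Proof.
have nsHG : H <| G by apply: der_normal.
have nilG := pgroup_nil pG.
have ntH : H :!=: 1 by apply: contraNneq ncH => ->; apply: cyclic1.
case: (boolP (H \subset 'Z(G))) => [sHZ | nsHZ]; [left; split=> // | right].
- have cG h g : h \in H -> g \in G -> h ^ g = h.
    move=> Hh Gg; apply/conjg_fixP/commgP.
    by case/setIP: (subsetP sHZ h Hh) => _ /centP; apply.
  have HR x y : x \in G -> y \in G -> [~ x, y] \in H by move=> *; apply: mem_commg.
  suff: ~~ [forall x in G, forall y in G, forall g in G,
      ([~ x, y] != 1) ==> ([~ g, y] \in <[[~ x, y]]>)].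
    case/forall_inPn=> x Gx /forall_inPn[y Gy /forall_inPn[g Gg]].
    by rewrite negb_imply => /andP[nt ngy]; exists x, y, g.
  (* Otherwise all commutators with a given entry lie on one line. If c and d span different lines,
     [[~ x, u]], [[~ x, v]] and [[~ u, y]] lie on both and vanish, so [x * u] has both c and d among
     its commutators. *)
  apply/negP => /forall_inP line.
  have {}line x y g : x \in G -> y \in G -> g \in G -> [~ x, y] != 1 ->
      [~ g, y] \in <[[~ x, y]]>.
    by move=> Gx Gy Gg nt; move/forall_inP: (line x Gx) => /(_ y Gy)/forall_inP/(_ g Gg)/implyP; apply.
  have lineV x y g : x \in G -> y \in G -> g \in G -> [~ x, y] != 1 ->
      [~ g, x] \in <[[~ x, y]]>.
    move=> Gx Gy Gg nt; rewrite -cycleV invg_comm; apply: line => //.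
    by rewrite -invg_comm invg_eq1.
  have /subsetPn[c /imset2P[x y Gx Gy def_c] ntc] : ~~ (commg_set G G \subset [1 gT]).
    by rewrite -gen_subG; apply: contraNN ntH => /trivgP e; apply/eqP.
  move: ntc; rewrite inE def_c => ntc.
  have /subsetPn[d /imset2P[u v Gu Gv def_d] nd] :
      ~~ (commg_set G G \subset <[[~ x, y]]>).
    by rewrite -gen_subG; apply: contraNN ncH => s; apply: cyclicS s (cycle_cyclic _).
  move: nd; rewrite def_d => nd {def_c def_d c d}.
  set c := [~ x, y] in ntc nd *; set d := [~ u, v] in nd *.
  have ntd : d != 1 by apply: contraNneq nd => ->; apply: group1.
  have tri z : z \in <[c]> -> z \in <[d]> -> z = 1.
    move=> zc zd; apply/set1gP; rewrite -(@prime_TIg _ <[d]> <[c]>) ?inE ?zc ?zd //.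
      by rewrite -orderE (nt_prime_order p_pr (der1_p2_expp (HR _ _ Gu Gv)) ntd).
    by rewrite cycle_subG.
  have vg a b : [~ b, a] \in <[c]> -> [~ a, b] \in <[c]>.
    by move=> h; rewrite -groupV invg_comm.
  have xu1 : [~ x, u] = 1 by apply: tri; [apply: vg; apply: lineV | apply: lineV].
  have xv1 : [~ x, v] = 1 by apply: tri; [apply: vg; apply: lineV | apply: line].
  have uy1 : [~ u, y] = 1.
    by apply: tri; [apply: line | rewrite -groupV invg_comm; apply: lineV].
  have xuy : [~ x * u, y] = c by rewrite commMgJ uy1 mulg1 cG ?HR.
  have xuv : [~ x * u, v] = d by rewrite commMgJ xv1 conj1g mul1g.
  have := lineV (x * u) y v; rewrite xuy groupM // => /(_ isT Gy Gv ntc).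
  by rewrite -groupV invg_comm xuv (negbTE nd).
- have p1 := prime_gt1 p_pr.
  set B := [~: H, G].
  have sBH : B \subset H by rewrite commg_subl normal_norm.
  split; first exact: sBH.
  have [v Gv Cv] : exists2 v, v \in G & v \notin 'C(H).
    by apply/subsetPn; apply: contraNN nsHZ; rewrite subsetI sHG centsC.
  have pBH : B \proper H.
    by apply: nil_comm_properl nilG sHG ntH _; rewrite subsetI subxx normal_norm.
  have nsBG : B <| G.
    by rewrite /normal (subset_trans sBH sHG) normsR ?normal_norm ?normG.
  pose D := (coset B @*^-1 'Z(G / B))%G.
  have [w Gw Dw] : exists2 w, w \in G & w \notin D.
    apply/subsetPn; apply: contraL pBH => sGD; rewrite properE negb_and negbK.
    apply/orP; right; rewrite -quotient_cents2 ?normal_norm //.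
    have := quotientS B sGD; rewrite cosetpreK => sZ.
    by rewrite (subset_trans sZ) // subIset // orbC centS.
  (* A group is not the union of two proper subgroups, here D and the centraliser of H. *)
  have [v' [Gv' Dv' Cv']] : exists v', [/\ v' \in G, v' \notin D & v' \notin 'C(H)].
    case: (boolP (v \in D)) => [Dv | nDv]; last by exists v.
    case: (boolP (w \in 'C(H))) => [Cw | nCw]; last by exists w.
    by exists (w * v); split; [apply: groupM | rewrite groupMr | rewrite groupMl].
  have Nv' : v' \in 'N(B) by apply: subsetP Gv'; apply: normal_norm.
  have [x Gx xv] : exists2 x, x \in G & [~ x, v'] \notin B.
    apply/exists_inP; apply: contraR Dv'; rewrite negb_exists_in => /forall_inP h.
    apply/morphpreP; split=> //; apply/centerP; split; first exact: mem_quotient.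
    move=> _ /morphimP[x Nx Gx ->]; have := h x Gx; rewrite negbK => hx.
    apply/commgP/eqP; rewrite -morphR //= coset_id //.
    by rewrite -groupV invg_comm.
  have [e He ev] : exists2 e, e \in H & [~ e, v'] != 1.
    apply/exists_inP; apply: contraR Cv'; rewrite negb_exists_in => /forall_inP h.
    by apply/centP => e He; apply/esym/commgP; rewrite -[_ == _]negbK h.
  by exists x, v', e.
Qed.

End OrderP2.

(** In the applications the quotient by N has order p^2 and exponent p, and this is linear
    independence over the field with p elements. *)
Definition indep_mod (gT : finGroupType) (p : nat) (N : {set gT}) (c d : gT) :=
  forall i j, c ^+ i * d ^+ j \in N -> (p %| i) && (p %| j).

Section DerivedQuotient.
Variables (gT : finGroupType) (p : nat) (G N : {group gT}).
Hypotheses (p_pr : prime p) (pG : p.-group G).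
Hypotheses (nsNG : N <| G) (sNH : N \subset G^`(1)).
Hypotheses (oHN : #|G^`(1) / N| = (p ^ 2)%N) (ncHN : ~~ cyclic (G^`(1) / N)).

Let nNG : G \subset 'N(N). Proof. exact: normal_norm. Qed.
Let sHG : G^`(1) \subset G. Proof. exact: der_sub. Qed.
Let pGN : p.-group (G / N). Proof. exact: quotient_pgroup. Qed.
Let derGN : (G / N)^`(1) = G^`(1) / N.
Proof. by rewrite -quotient_der. Qed.

Lemma der1_quotient_expp c : c \in G^`(1) -> c ^+ p \in N.
Proof.
move=> Hc; have Nc : c \in 'N(N) by apply: subsetP (subset_trans sHG nNG) c Hc.
apply: coset_idr; first exact: groupX.
rewrite morphX //; apply: (@der1_p2_expp _ p (G / N)) => //; rewrite derGN //.
exact: mem_quotient.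
Qed.

Lemma indep_mod_coset c d : c \in G^`(1) -> d \in G^`(1) ->
  c \notin N -> coset N d \notin <[coset N c]> -> indep_mod p N c d.
Proof.
move=> Hc Hd Nc ndc i j e.
have [NNc NNd] : c \in 'N(N) /\ d \in 'N(N).
  by split; apply: subsetP (subset_trans sHG nNG) _ _.
apply: (@der1_p2_indep _ _ _ p_pr pGN _ _ (coset N c) (coset N d));
  rewrite ?derGN ?mem_quotient //.
  by apply: contraNneq Nc => /coset_idr; apply.
by rewrite -!morphX // -morphM ?groupX //= coset_id.
Qed.

(** In the second case B contains [[~ e, v]] but not [[~ x, v]]; [comm_line_power] needs such a
    separating subgroup. *)
Lemma der1_quotient_dichotomy :
  ([~: G^`(1), G] \subset N /\ exists x y g, [/\ x \in G, y \in G, g \in G &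
      indep_mod p N [~ x, y] [~ g, y]])
  \/ exists x v e, exists B : {group gT},
      [/\ x \in G, v \in G, e \in G^`(1) & indep_mod p N [~ x, v] [~ e, v]]
      /\ [/\ N \subset B, [~: G^`(1), G] \subset B & [~ x, v] \notin B].
Proof.
have inN z : z \in G -> z \in 'N(N) by apply: subsetP.
have RH x y : x \in G -> y \in G -> [~ x, y] \in G^`(1).
  by move=> *; apply: mem_commg.
have [||[sHZ [x' [y' [g' [Gx Gy Gg ntc nd]]]]]|[sBH [x' [v' [e' [Gx Gv He nc nte]]]]]] :=
    @der1_p2_dichotomy _ p (G / N)%G p_pr pGN; rewrite /= ?derGN //.
- left; split.
    rewrite -quotient_cents2 ?(subset_trans sHG) //.
    by rewrite -derGN (subset_trans sHZ) // subsetIr.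
  case/morphimP: Gx ntc nd => x Nx Gx -> ; case/morphimP: Gy => y Ny Gy ->.
  case/morphimP: Gg => g Ng Gg ->; rewrite -!morphR //= => ntc nd.
  exists x, y, g; split=> //; apply: indep_mod_coset; rewrite ?RH //.
  by apply: contraNN ntc => h; rewrite coset_id.
right; move: sBH He nc; rewrite /= derGN -quotientR ?(subset_trans sHG) // => sBH.
case/morphimP: Gx nte => x Nx Gx ->; case/morphimP: Gv => v Nv Gv -> + /morphimP[e Ne He ed].
have Ge := subsetP sHG e He.
rewrite ed -!morphR //= => nte nc; exists x, v, e, ([~: G^`(1), G] <*> N)%G.
have sBG : [~: G^`(1), G] \subset 'N(N).
  by apply: subset_trans nNG; rewrite comm_subG.
have ncB : [~ x, v] \notin [~: G^`(1), G] <*> N.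
  apply: contra nc => h; have := mem_quotient N h.
  by rewrite quotientYidr.
split; split; rewrite ?joing_subl ?joing_subr //.
apply: indep_mod_coset; rewrite ?RH //.
  by apply: contra ncB => h; rewrite (subsetP (joing_subr _ _)).
(* A line through [x, v] containing [e, v] would be [~: H, G]. *)
apply: contra nc => h.
have ev : coset N [~ e, v] \in [~: G^`(1), G] / N.
  by rewrite mem_quotient // mem_commg.
have oc : #[coset N [~ x, v]] = p.
  apply: nt_prime_order => //.
    apply: (@der1_p2_expp _ p (G / N)) => //; rewrite derGN // mem_quotient ?RH //.
  apply: contraNneq nte => c1; move: h; rewrite c1 cycle1 inE.
  by [].
rewrite -cycle_subG (subset_trans _ (_ : <[coset N [~ e, v]]> \subset _)) ?cycle_subG //.
have prc : prime #|<[coset N [~ x, v]]>| by rewrite -orderE oc.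
have : <[coset N [~ x, v]]> :&: <[coset N [~ e, v]]> != 1.
  apply: contraNneq nte => e1; apply/eqP/set1gP; rewrite -e1 inE h cycle_id //.
by apply: contraNT => h2; rewrite (prime_TIg prc) ?cycle_subG.
Qed.

End DerivedQuotient.

Lemma neq_mod_pfactor p m a b : prime p -> a <= m -> b <= m -> a != b ->
  exists v, [/\ v <= m, a = b %[mod p ^ v] & a <> b %[mod p ^ v.+1]].
Proof.
move=> p_pr; wlog ltab : a b / a < b => [IH | lea leb neab].
  move=> lea leb neab; case: (ltngtP a b) (neab) => // lt _.
    exact: IH.
  have [|v [lev e ne]] := IH b a lt leb lea; first by rewrite eq_sym.
  by exists v; split=> // /esym.
have D0 : 0 < b - a by rewrite subn_gt0.
exists (logn p (b - a)); split.
- apply: leq_trans (leq_trans (leq_subr a b) leb).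
  by apply: leq_trans (ltnW (ltn_logl p D0)) _.
- apply/esym/eqP; rewrite eqn_mod_dvd ?(ltnW ltab) //; apply: pfactor_dvdnn.
- move/esym/eqP; rewrite eqn_mod_dvd ?(ltnW ltab) //.
  by rewrite pfactor_dvdn // ltnn.
Qed.

(** For a p-element f, the subgroup [<[f ^+ t]>] depends only on the valuation v of t, so it
    contains [f ^+ (p ^ m)] whenever m is at least v. *)
Lemma mem_cycle_pX (gT : finGroupType) p (f : gT) t v m (C : {group gT}) :
    prime p -> p.-elt f -> v <= m -> p ^ v %| t -> ~~ (p ^ v.+1 %| t) ->
  f ^+ t \in C -> f ^+ (p ^ m) \in C.
Proof.
move=> p_pr pf lev /dvdnP[t' ->]; rewrite expnS dvdn_pmul2r ?expn_gt0 ?prime_gt0 //.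
move=> npt'; rewrite mulnC expgM => fC.
have -> : f ^+ (p ^ m) = (f ^+ (p ^ v)) ^+ (p ^ (m - v)).
  by rewrite -expgM -expnD subnKC.
apply: groupX; set g := f ^+ _ in fC *.
have pg : p.-elt g by apply: mem_p_elt pf _; rewrite ?mem_cycle.
have co : coprime #[g] t'.
  have /p_natP[j ->] := pg.
  by rewrite coprimeXl // prime_coprime.
have := generator_coprime g t'; rewrite co => /eqP eg.
by rewrite -cycle_subG eg cycle_subG.
Qed.

(** * Independence modulo a subgroup containing all elements of smaller exponent *)

Section Independence.
Variables (gT : finGroupType) (p k : nat) (H : {group gT}) (N : {set gT}).
Hypotheses (p_pr : prime p) (k_gt0 : 0 < k) (abH : abelian H).
Hypotheses (expH : forall h, h \in H -> h ^+ (p ^ k) = 1).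
Hypotheses (lowH : forall h, h \in H -> h ^+ (p ^ k.-1) = 1 -> h \in N).

Let cHH x y : x \in H -> y \in H -> commute x y.
Proof. by move=> Hx Hy; apply: (centsP abH). Qed.

Let XM x y n : x \in H -> y \in H -> (x * y) ^+ n = x ^+ n * y ^+ n.
Proof. by move=> Hx Hy; apply/expgMn/cHH. Qed.

Lemma low_exponent h l : h \in H -> l < k -> h ^+ (p ^ l) = 1 -> h \in N.
Proof.
move=> Hh ltl e; apply: lowH => //.
have -> : (p ^ k.-1)%N = (p ^ l * p ^ (k.-1 - l))%N.
  by rewrite -expnD subnKC // -ltnS prednK.
by rewrite expgM e expg1n.
Qed.

Section Pair.
Variables c d : gT.
Hypotheses (Hc : c \in H) (Hd : d \in H) (ind : indep_mod p N c d).

(** Once [p ^ j] is divided out of both exponents, the element is killed by [p ^ (j + l)]. While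
    [j + l < k] it therefore lies in N, and independence splits off one more factor p. *)
Lemma indep_mod_root a b l : (c ^+ a * d ^+ b) ^+ (p ^ l) = 1 ->
  (p ^ (k - l) %| a) && (p ^ (k - l) %| b).
Proof.
move=> e; suff IH j : j <= k - l -> (p ^ j %| a) && (p ^ j %| b) by apply: IH.
elim: j => [|j IH] lej; first by rewrite expn0 !dvd1n.
have /andP[/dvdnP[a' ea] /dvdnP[b' eb]] := IH (ltnW lej).
have : c ^+ a' * d ^+ b' \in N.
  apply: (@low_exponent _ (j + l)); first by rewrite groupM ?groupX.
    by rewrite -ltn_subRL; move: lej; rewrite ltn_subRL addnC -ltn_subRL.
  rewrite expnD expgM -{}e ea eb; congr (_ ^+ _).
  by rewrite XM ?groupX // -!expgM.
case/ind/andP=> pa pb; rewrite ea eb expnS !dvdn_pmul2r ?expn_gt0 ?prime_gt0 //.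
by rewrite pa.
Qed.

Lemma indep_mod_inj a b a' b' l :
    (c ^+ a * d ^+ b) ^+ (p ^ l) = (c ^+ a' * d ^+ b') ^+ (p ^ l) ->
  a = a' %[mod p ^ (k - l)] /\ b = b' %[mod p ^ (k - l)].
Proof.
have pk0 : 0 < p ^ k by rewrite expn_gt0 prime_gt0.
(* Exponents are natural numbers, so [(p ^ k).-1] plays the part of -1. *)
have invX x n : x \in H -> x ^+ ((p ^ k).-1 * n) = (x ^+ n)^-1.
  move=> Hx; apply/eqP; rewrite eq_sym eq_invg_mul -expgD -mulSn prednK //.
  by rewrite expgM expH // expg1n.
have red n n' : p ^ (k - l) %| n + (p ^ k).-1 * n' -> n = n' %[mod p ^ (k - l)].
  have /dvdnP[q eq] : p ^ (k - l) %| p ^ k by rewrite dvdn_exp2l // leq_subr.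
  case/dvdnP=> r er; have e : (q * n' * p ^ (k - l) + n = r * p ^ (k - l) + n')%N.
    by rewrite -er -addnA -mulSnr prednK // addnC mulnAC -eq.
  by rewrite -(modnMDl (q * n')) e modnMDl.
move=> e; have := @indep_mod_root (a + (p ^ k).-1 * a') (b + (p ^ k).-1 * b') l.
have -> : c ^+ (a + (p ^ k).-1 * a') * d ^+ (b + (p ^ k).-1 * b') =
    (c ^+ a * d ^+ b) * (c ^+ a' * d ^+ b')^-1.
  rewrite !expgD !invX // invMg [(_)^-1 * _]cHH ?groupV ?groupX //.
  rewrite -!mulgA; congr (_ * _); rewrite !mulgA; congr (_ * _).
  by apply: cHH; rewrite ?groupV ?groupX.
rewrite XM ?groupV ?groupM ?groupX // expgVn e mulgV => /(_ erefl)/andP[? ?].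
by split; apply: red.
Qed.

End Pair.

(* If one of [c f^a], [c f^b] is a power of the other, then the exponent is 1
   modulo p, and comparing p-adic valuations forces [f^(p^m)] into [<c>]. *)
Lemma coset_line_power (B : {group gT}) m c f a b :
    m < k -> N \subset B -> c \in H -> f \in H -> f \in B -> c \notin B ->
    (forall s, c ^+ s \in B -> p %| s) ->
    a <= m -> b <= m -> a != b -> c * f ^+ a \in <[c * f ^+ b]> ->
  f ^+ (p ^ m) \in <[c]>.
Proof.
move=> ltmk sNB Hc Hf Bf Bc cB lea leb neab /cycleP[[|s] e].
  case/negP: Bc; rewrite -(groupMr _ (groupX a Bf)) e expg0; exact: group1.
have pk0 : 0 < p ^ k by rewrite expn_gt0 prime_gt0.
have [v [lev eqv neqv]] := neq_mod_pfactor p_pr lea leb neab.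
(* t stands for [b * s.+1 - a] modulo [p ^ k], so that [c ^+ s * f ^+ t = 1]. *)
set t := (b * s.+1 + (p ^ k).-1 * a)%N.
have ta : (t + a = b + b * s + p ^ k * a)%N.
  by rewrite /t -addnA -mulSnr prednK // mulnS.
have cst : c ^+ s * f ^+ t = 1.
  apply: (mulgI c); rewrite mulgA -expgS mulg1 /t expgD mulgA.
  have -> : c ^+ s.+1 * f ^+ (b * s.+1) = c * f ^+ a.
    by rewrite e XM ?groupX // -expgM.
  by rewrite -mulgA -expgD -mulSn prednK // expgM expH // expg1n mulg1.
have ps : p %| s.
  apply: cB; rewrite -(groupMr _ (groupX t Bf)) cst; exact: group1.
have pt j : j <= v -> p ^ j %| s -> p ^ j %| t.
  move=> lej /dvdnP[q es]; have lejk : j <= k.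
    by apply: leq_trans lej (leq_trans lev (ltnW ltmk)).
  suff: t + a == 0 + a %[mod p ^ j] by rewrite eqn_modDr mod0n.
  rewrite add0n ta es.
  have /dvdnP[r ->] : p ^ j %| p ^ k by rewrite dvdn_exp2l.
  rewrite mulnA [(r * _ * a)%N]mulnAC -addnA -mulnDl addnC modnMDl.
  have /dvdnP[r' er] : p ^ j %| p ^ v by rewrite dvdn_exp2l.
  have dv : p ^ j %| p ^ v by rewrite dvdn_exp2l.
  by apply/eqP; rewrite -(modn_dvdm a dv) eqv modn_dvdm.
(* If [p ^ j] divides s and t with j <= v, then [c ^+ s' * f ^+ t'] is killed by [p ^ j], so it lies
   in N, and s gains a factor p. Thus s reaches [p ^ v.+1], while t, being [b - a] modulo that
   power, has valuation exactly v. *)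
have psj j : j <= v.+1 -> p ^ j %| s.
  elim: j => [|j IH] lej; first by rewrite dvd1n.
  have [/dvdnP[s' es] /dvdnP[t' et]] := (IH (ltnW lej), pt j lej (IH (ltnW lej))).
  have cs' : c ^+ s' * f ^+ t' \in N.
    apply: (@low_exponent _ j); first by rewrite groupM ?groupX.
      by apply: leq_ltn_trans ltmk; apply: leq_trans lev.
    by rewrite XM ?groupX // -!expgM -es -et.
  have /cB : c ^+ s' \in B.
    by rewrite -(groupMr _ (groupX t' Bf)) (subsetP sNB).
  by rewrite es expnS dvdn_pmul2r // expn_gt0 prime_gt0.
apply: (mem_cycle_pX p_pr _ lev (pt v (leqnn v) (psj v (leqnSn v)))).
- by apply: (@pnat_dvd _ (p ^ k)); rewrite ?pnatX ?pnat_id // order_dvdn expH.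
- apply/negP=> pvt; case: neqv.
  have /dvdnP[q es] := psj v.+1 (leqnn _).
  have /dvdnP[r er] : p ^ v.+1 %| p ^ k by rewrite dvdn_exp2l // (leq_ltn_trans lev).
  have /dvdnP[u eu] := pvt.
  rewrite -(modnMDl u) -eu ta es er mulnA [(r * _ * a)%N]mulnAC -addnA -mulnDl addnC.
  by rewrite modnMDl.
have -> : f ^+ t = (c ^+ s)^-1 by apply/eqP; rewrite eq_sym eq_invg_mul cst.
by rewrite groupV mem_cycle.
Qed.

End Independence.

(** * Noncyclic quotients of order p^2 of an abelian derived group *)

Section UniformRank2.
Variables (gT : finGroupType) (p m k : nat) (G N : {group gT}).
Hypotheses (p_pr : prime p) (pG : p.-group G) (cov : comm_cover m G).
Hypotheses (abH : abelian G^`(1)) (nsNG : N <| G) (sNH : N \subset G^`(1)).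
Hypotheses (oHN : #|G^`(1) / N| = (p ^ 2)%N) (ncHN : ~~ cyclic (G^`(1) / N)).
Hypotheses (k_gt0 : 0 < k) (expH : forall h, h \in G^`(1) -> h ^+ (p ^ k) = 1).
Hypotheses (lowH : forall h, h \in G^`(1) -> h ^+ (p ^ k.-1) = 1 -> h \in N).

Let H := G^`(1)%G.
Let sHG : H \subset G. Proof. exact: der_sub. Qed.
Let nHG g h : g \in G -> h \in H -> h ^ g \in H.
Proof. by move=> Gg Hh; rewrite memJ_norm // (subsetP (normal_norm (der_normal 1 G))). Qed.
Let HR x y : x \in G -> y \in G -> [~ x, y] \in H.
Proof. by move=> *; apply: mem_commg. Qed.
Let HRl h y : h \in H -> y \in G -> [~ h, y] \in H.
Proof. by move=> Hh Gy; rewrite groupM ?groupV ?nHG. Qed.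
Let HRr h y : h \in H -> y \in G -> [~ y, h] \in H.
Proof. by move=> Hh Gy; rewrite -groupV invg_comm HRl. Qed.
Let cHH x y : x \in H -> y \in H -> commute x y.
Proof. by move=> Hx Hy; apply: (centsP abH). Qed.
Let JH x h : x \in H -> h \in H -> x ^ h = x.
Proof. by move=> Hx Hh; rewrite conjgE (cHH Hx Hh) mulKg. Qed.
Let XM x y n : x \in H -> y \in H -> (x * y) ^+ n = x ^+ n * y ^+ n.
Proof. by move=> Hx Hy; apply/expgMn/cHH. Qed.
Let mulACA q a b w : a \in H -> b \in H -> q * a * (b * w) = q * b * (a * w).
Proof. by move=> Ha Hb; rewrite !mulgA -(mulgA q) (cHH Ha Hb) mulgA. Qed.
Let pH h : h \in H -> p.-elt h.
Proof. by move=> Hh; apply: mem_p_elt pG (subsetP sHG _ Hh). Qed.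

Lemma derived_mod_power (B : {group gT}) c : c \in H -> c \notin B ->
  forall s, c ^+ s \in B -> p %| s.
Proof.
move=> Hc Bc s cs; apply: contraNT Bc => nps.
rewrite -[c]expg1 -[1%N](expn0 p).
by apply: (mem_cycle_pX p_pr (pH Hc) (leqnn 0) _ _ cs); rewrite ?dvd1n ?expn1.
Qed.

(** The commutators [[~ x * h ^+ i, y]] are [c * [~ h, y] ^+ i], and the pigeonhole applies to i <=
    m. Multiplying the second entry by [h ^+ i] instead gives the other half. *)
Lemma comm_line_power (B : {group gT}) x y h : m < k ->
    N \subset B -> [~: H, G] \subset B -> x \in G -> y \in G -> h \in H ->
    [~ x, y] \notin B ->
  [~ h, y] ^+ (p ^ m) \in <[[~ x, y]]> /\ [~ h, x] ^+ (p ^ m) \in <[[~ x, y]]>.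
Proof.
move=> ltmk sNB sHGB Gx Gy Hh Bc; set c := [~ x, y] in Bc *.
have Gh := subsetP sHG h Hh; have Hc : c \in H by apply: HR.
suff main f : f \in H -> f \in B ->
    (forall i, exists u v, [/\ u \in G, v \in G & c * f ^+ i = [~ u, v]]) ->
    f ^+ (p ^ m) \in <[c]>.
  split.
    apply: main; rewrite ?HRl ?(subsetP sHGB) ?mem_commg // => i.
    exists (x * h ^+ i), y; rewrite groupM ?groupX //; split=> //.
    rewrite commMgJ JH ?groupX //; congr (_ * _).
    by rewrite commXg //; apply: cHH; rewrite ?HRl.
  rewrite -groupV -expgVn invg_comm; apply: main; rewrite ?HRr //.
    by rewrite -groupV invg_comm (subsetP sHGB) ?mem_commg.
  move=> i; exists x, (y * h ^+ i); rewrite groupM ?groupX //; split=> //.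
  rewrite commgMJ JH ?groupX // commgX; last by apply: cHH; rewrite ?HRr.
  by apply: cHH => //; rewrite groupX // HRr.
move=> Hf Bf fP.
have [i [j [/andP[ltij lejm] ij]]] :=
  comm_cover_pigeon p_pr pG cov (fun i _ => fP i).
have leim : i <= m by apply: ltnW (leq_trans ltij lejm).
have clp := coset_line_power p_pr k_gt0 abH expH lowH ltmk sNB Hc Hf Bf Bc
  (derived_mod_power Hc Bc).
case: ij => ij; first by apply: clp leim lejm _ ij; rewrite ltn_eqF.
by apply: clp lejm leim _ ij; rewrite gtn_eqF.
Qed.

Lemma indep_mod_TI c d z : c \in H -> d \in H -> indep_mod p N c d ->
  z \in <[c]> -> z \in <[d]> -> z = 1.
Proof.
move=> Hc Hd ind /cycleP[i ->] /cycleP[j e].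
have := indep_mod_inj p_pr k_gt0 abH expH lowH Hc Hd ind (a := i) (b := 0)
  (a' := 0) (b' := j) (l := 0).
rewrite !expg0 mulg1 mul1g e subn0 => /(_ erefl)[/eqP].
rewrite mod0n => /dvdnP[q eq] _; rewrite -e eq mulnC expgM expH //.
exact: expg1n.
Qed.

Lemma indep_mod_mulN c d n : c \in H -> d \in H -> n \in N ->
  indep_mod p N c d -> indep_mod p N (c * n) d.
Proof.
move=> Hc Hd Nn ind i j; have Hn := subsetP sNH n Nn.
rewrite XM // -mulgA (cHH (groupX i Hn) (groupX j Hd)) mulgA.
by rewrite groupMr ?groupX //; apply: ind.
Qed.

(* With [x] nearly central on [H], the commutators [x^(p^j) g, y] are
   c^(p^j) d up to a factor of small order, and lie in different cyclic
   subgroups. *)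
Lemma uniform_rank2_contra x y g : m + m < k -> [~: H, G] \subset N ->
    x \in G -> y \in G -> g \in G -> indep_mod p N [~ x, y] [~ g, y] ->
    (forall h, h \in H -> [~ h, x] ^+ (p ^ m) = 1) -> False.
Proof.
move=> ltk sHGN Gx Gy Gg; set c := [~ x, y]; set d := [~ g, y] => ind smallx.
have [Hc Hd] : c \in H /\ d \in H by split; apply: HR.
set c' := c ^ g; have Hc' : c' \in H by rewrite nHG.
have ind' : indep_mod p N c' d.
  rewrite /c' conjg_mulR; apply: indep_mod_mulN => //.
  by rewrite (subsetP sHGN) ?mem_commg.
have small n h : h \in H -> [~ h, x ^+ n] ^+ (p ^ m) = 1.
  move=> Hh; elim: n => [|n IH]; first by rewrite expg0 commg1 expg1n.
  rewrite expgS commgMJ XM ?nHG ?HRl ?groupX // -conjXg smallx // conj1g mulg1.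
  exact: IH.
have commX n : exists w, [/\ w \in H, w ^+ (p ^ m) = 1 &
    [~ x ^+ n, y] = c ^+ n * w].
  elim: n => [|n [w [Hw w1 IH]]].
    by exists 1; rewrite group1 expg1n !expg0 comm1g mulg1.
  have Hcx : [~ c, x ^+ n] \in H by rewrite HRl ?groupX.
  exists ([~ c, x ^+ n] * w); split; first by rewrite groupM.
    by rewrite XM // small // w1 mulg1.
  by rewrite expgS commMgJ IH -/c conjg_mulR expgS mulACA ?groupX.
have commXd j : exists w, [/\ w \in H, w ^+ (p ^ m) = 1 &
    [~ x ^+ (p ^ j) * g, y] = c' ^+ (p ^ j) * w * d].
  have [w [Hw w1 e]] := commX (p ^ j)%N.
  exists (w ^ g); rewrite nHG // -conjXg w1 conj1g; split=> //.
  by rewrite commMgJ e conjMg conjXg.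
have powE u v w a r : u \in H -> v \in H -> w \in H -> w ^+ (p ^ m) = 1 ->
    (u ^+ a * w * v) ^+ r ^+ (p ^ m) = (u ^+ (a * r) * v ^+ r) ^+ (p ^ m).
  move=> Hu Hv Hw w1; rewrite !XM ?groupM ?groupX // -!expgM.
  by rewrite -mulnA (mulnC r) mulnA [w ^+ _]expgM w1 expg1n mulg1 ?mulnA.
have [i _|i [j [/andP[ltij lejm] ij]]] :=
    comm_cover_pigeon p_pr pG cov (f := fun j => [~ x ^+ (p ^ j.+1) * g, y]).
  by exists (x ^+ (p ^ i.+1) * g), y; rewrite groupM ?groupX.
have powI i1 j1 r :
    [~ x ^+ (p ^ i1) * g, y] = [~ x ^+ (p ^ j1) * g, y] ^+ r ->
    p ^ i1 = p ^ j1 * r %[mod p ^ (k - m)] /\ 1 = r %[mod p ^ (k - m)].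
  have [w1 [Hw1 ow1 ->]] := commXd i1; have [w2 [Hw2 ow2 ->]] := commXd j1.
  move=> /(congr1 (fun z => z ^+ (p ^ m))); rewrite powE //.
  have := powE c' d w1 (p ^ i1)%N 1%N Hc' Hd Hw1 ow1; rewrite muln1 !expg1 => -> e.
  have := indep_mod_inj p_pr k_gt0 abH expH lowH Hc' Hd ind' (b := 1%N) (l := m).
  by rewrite expg1; apply.
(* Here [m + m < k] is needed: the power [p ^ m] that removes w costs m factors p, and up to [m.+1]
   more must remain to distinguish the valuations. *)
have pi2 : p ^ i.+2 %| p ^ (k - m).
  rewrite dvdn_exp2l // leq_subRL; last by apply: leq_trans (leq_addr m m) (ltnW ltk).
  by apply: leq_trans ltk; rewrite -addnS leq_add2l ltnS (leq_trans ltij).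
have pi1 r : p ^ i.+2 %| p ^ i.+1 * r = (p %| r).
  by rewrite [(p ^ i.+2)%N]expnSr dvdn_pmul2l ?expn_gt0 ?prime_gt0.
have modE a b : a = b %[mod p ^ (k - m)] -> p ^ i.+2 %| a -> p ^ i.+2 %| b.
  move=> e; rewrite /dvdn -(modn_dvdm a pi2) e modn_dvdm //.
have pj : p ^ i.+2 %| p ^ j.+1 by rewrite dvdn_exp2l.
case: ij => /cycleP[r e]; have [e1 e2] := powI _ _ _ e.
  have := modE _ _ (esym e1) (dvdn_mulr r pj).
  by rewrite -[(p ^ i.+1)%N]muln1 pi1 dvdn1; case: (p) p_pr => [|[|]].
have := modE _ _ e1 pj; rewrite pi1 => pr.
have : p %| 1.
  have pk : p %| p ^ (k - m) by apply: dvdn_trans pi2; rewrite expnS dvdn_mulr.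
  by rewrite /dvdn -(modn_dvdm 1 pk) e2 modn_dvdm.
by rewrite dvdn1; case: (p) p_pr => [|[|]].
Qed.

(** When [[~ H, G]] lies in N, an element with two commutators independent modulo N is nearly
    central on H: by [comm_line_power] the [p ^ m]-th powers of its commutators with H lie in two
    cyclic groups that meet trivially. One of x, u, [y * u] is such an element. *)
Lemma uniform_rank2_bound : k <= m + m.
Proof.
rewrite leqNgt; apply/negP=> ltk.
have ltmk : m < k by apply: leq_ltn_trans (leq_addr m m) ltk.
have [[sHGN [x [y [u [Gx Gy Gu ind]]]]] | [x [v [e [B [[Gx Gv He ind] [sNB sHB Bc]]]]]]] :=
  der1_quotient_dichotomy p_pr pG nsNG oHN ncHN; last first.
  (* [[~ e, v] ^+ (p ^ m)] lies in both cyclic groups, so it is 1, which places [[~ e, v]] in N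
     against independence. *)
  have [e1 _] := comm_line_power ltmk sNB sHB Gx Gv He Bc.
  have [Hc Hd] : [~ x, v] \in H /\ [~ e, v] \in H by rewrite HR ?HRl.
  have ev1 := indep_mod_TI Hc Hd ind e1 (mem_cycle _ _).
  have Nev := low_exponent k_gt0 lowH Hd ltmk ev1.
  have := ind 0 1%N; rewrite expg0 mul1g expg1 => /(_ Nev).
  by rewrite dvdn1; case: (p) p_pr => [|[|]] //; rewrite andbF.
set c := [~ x, y] in ind; set d := [~ u, y] in ind.
have [Hc Hd] : c \in H /\ d \in H by rewrite !HR.
have p1 : (p %| 1) = false by rewrite dvdn1; case: (p) p_pr => [|[|]].
have Nc : c \notin N.
  by apply/negP=> Nc; have := ind 1%N 0; rewrite expg0 expg1 mulg1 p1 => /(_ Nc).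
have Nd : d \notin N.
  by apply/negP=> Nd; have := ind 0 1%N; rewrite expg0 expg1 mul1g p1 andbF => /(_ Nd).
have ind' : indep_mod p N d c.
  by move=> i j; rewrite (cHH (groupX i Hd) (groupX j Hc)) andbC; apply: ind.
have LC := comm_line_power ltmk (subxx N) sHGN.
case: (boolP ([~ x, u] \in N)) => Ne.
  have e1 : [~ y * u, y] = d by rewrite commMgJ commgg conj1g mul1g.
  have e2 : exists2 n, n \in N & [~ x, y * u] = c * n.
    exists ([~ c, u] * [~ x, u]).
      by rewrite groupM // (subsetP sHGN) ?mem_commg.
    rewrite commgMJ -/c conjg_mulR [RHS](mulgA c).
    by apply: cHH; [apply: HR | apply: groupM Hc (HRl Hc Gu)].
  have [n Nn e3] := e2; have ind1 := indep_mod_mulN Hc Hd Nn ind.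
  apply: (uniform_rank2_contra ltk sHGN (x := y * u) (y := y) (g := x));
    rewrite ?groupM // ?e1 // => h Hh.
  apply: (indep_mod_TI (groupM Hc (subsetP sNH n Nn)) Hd ind1).
    rewrite -e3; apply: (LC x (y * u) h Gx (groupM Gy Gu) Hh _).1.
    by rewrite e3 groupMr.
  by rewrite -e1; apply: (LC (y * u) y h (groupM Gy Gu) Gy Hh _).2; rewrite e1.
have He : [~ x, u] \in H by rewrite HR.
have smallx : coset N [~ x, u] \notin <[coset N c]> ->
    forall h, h \in H -> [~ h, x] ^+ (p ^ m) = 1.
  move=> nec h Hh; have inde := indep_mod_coset p_pr pG nsNG oHN ncHN Hc He Nc nec.
  by apply: (indep_mod_TI Hc He inde); [apply: (LC _ _ _ _ _ _ _).2 | apply: (LC _ _ _ _ _ _ _).2].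
have smallu : coset N [~ x, u] \notin <[coset N d]> ->
    forall h, h \in H -> [~ h, u] ^+ (p ^ m) = 1.
  move=> ned h Hh; have inde := indep_mod_coset p_pr pG nsNG oHN ncHN Hd He Nd ned.
  by apply: (indep_mod_TI Hd He inde); [apply: (LC _ _ _ _ _ _ _).2 | apply: (LC _ _ _ _ _ _ _).1].
case: (boolP (coset N [~ x, u] \in <[coset N c]>)) => [ec | /smallx]; last first.
  exact: uniform_rank2_contra ltk sHGN Gx Gy Gu ind.
case: (boolP (coset N [~ x, u] \in <[coset N d]>)) => [ed | /smallu]; last first.
  exact: uniform_rank2_contra ltk sHGN Gu Gy Gx ind'.
(* Modulo N, an element on the lines of both c and d is trivial. *)
case/negP: Ne.
have inN z : z \in H -> z \in 'N(N).
  by move=> Hz; apply: (subsetP (normal_norm nsNG)); apply: (subsetP sHG).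
apply: coset_idr; first exact: inN.
have [/cycleP[i ei] /cycleP[j ej]] := (ec, ed).
rewrite ei -morphX ?inN //= coset_id //.
have pN z : z \in H -> z ^+ p \in N by apply: (der1_quotient_expp p_pr pG nsNG oHN ncHN).
have /ind/andP[/dvdnP[q ->] _] : c ^+ i * d ^+ ((p ^ k).-1 * j) \in N.
  apply: coset_idr; first by rewrite groupM ?groupX ?inN.
  rewrite morphM ?groupX ?inN // morphX ?inN // -ei ej -morphX ?inN //=.
  rewrite -morphM ?groupX ?inN //= -expgD -mulSn prednK ?expn_gt0 ?prime_gt0 //.
  by rewrite expgM expH // expg1n morph1.
by rewrite mulnC expgM groupX ?pN.
Qed.

End UniformRank2.

(** * Derived groups with a central subgroup of order p and cyclic quotient *)

Section CyclicByPrime.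
Variables (gT : finGroupType) (p m k : nat) (G T : {group gT}).
Hypotheses (p_pr : prime p) (pG : p.-group G) (cov : comm_cover m G).
Hypotheses (sTH : T \subset G^`(1)) (sTZ : T \subset 'Z(G)) (oT : #|T| = p).
Hypotheses (cHT : cyclic (G^`(1) / T)) (ncH : ~~ cyclic G^`(1)).
Hypothesis oHT : #|G^`(1) / T| = (p ^ k)%N.

Let H := G^`(1)%G.
Let sHG : H \subset G. Proof. exact: der_sub. Qed.
Let nTG : G \subset 'N(T).
Proof. by apply: cents_norm; rewrite centsC; apply: subset_trans sTZ (subsetIr _ _). Qed.
Let nTH : H \subset 'N(T). Proof. exact: subset_trans sHG nTG. Qed.
Let nHG g h : g \in G -> h \in H -> h ^ g \in H.
Proof. by move=> Gg Hh; rewrite memJ_norm // (subsetP (normal_norm (der_normal 1 G))). Qed.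
Let HR x y : x \in G -> y \in G -> [~ x, y] \in H.
Proof. by move=> *; apply: mem_commg. Qed.
Let HRl h y : h \in H -> y \in G -> [~ h, y] \in H.
Proof. by move=> Hh Gy; rewrite groupM ?groupV ?nHG. Qed.
Let abH : abelian H.
Proof.
apply: (@cyclic_factor_abelian _ T) => //; rewrite subsetI sTH.
by apply: subset_trans sTZ (subset_trans (subsetIr _ _) (centS sHG)).
Qed.
Let cHH x y : x \in H -> y \in H -> commute x y.
Proof. by move=> Hx Hy; apply: (centsP abH). Qed.
Let JH x h : x \in H -> h \in H -> x ^ h = x.
Proof. by move=> Hx Hh; rewrite conjgE (cHH Hx Hh) mulKg. Qed.
Let XM x y n : x \in H -> y \in H -> (x * y) ^+ n = x ^+ n * y ^+ n.
Proof. by move=> Hx Hy; apply/expgMn/cHH. Qed.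
Let pH : p.-group H. Proof. exact: pgroupS sHG pG. Qed.
Let JT t g : t \in T -> g \in G -> t ^ g = t.
Proof.
move=> Tt Gg; have /setIP[_ /centP cG] := subsetP sTZ t Tt.
by apply/conjg_fixP/commgP; apply: cG.
Qed.
Let TH t : t \in T -> t \in H. Proof. exact: subsetP. Qed.
Let Tp t : t \in T -> t ^+ p = 1. Proof. by move=> Tt; rewrite -oT expg_cardG. Qed.

(** N is the Frattini subgroup of H, and B is the maximal subgroup of H containing T. *)
Let N := 'Mho^1(H)%G.
Let B := (T <*> N)%G.

Let NE : N :=: [set h ^+ p | h in H].
Proof. by rewrite /N /= (MhoEabelian 1 pH abH). Qed.
Let Np h : h \in H -> h ^+ p \in N.
Proof. by move=> Hh; rewrite -[gval N]/(gval N) NE; apply: imset_f. Qed.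
Let sNH : N \subset H. Proof. exact: Mho_sub. Qed.
Let sTB : T \subset B. Proof. exact: joing_subl. Qed.
Let sNB : N \subset B. Proof. exact: joing_subr. Qed.
Let sBH : B \subset H. Proof. by rewrite join_subG sTH. Qed.
Let charN : N \char H. Proof. exact: Mho_char. Qed.
Let nsNG : N <| G. Proof. by apply: char_normal_trans (der_normal 1 G). Qed.

(* Exactly the elements of [H] outside [B]; [<c>] is then a complement of [T]. *)
Definition gen_mod c := c \in H /\
  forall h, h \in H -> exists a t, t \in T /\ h = c ^+ a * t.

Lemma gen_mod_exists : exists c, gen_mod c.
Proof.
have /cyclicP[x ex] := cHT.
have : x \in H / T by rewrite ex cycle_id.
case/morphimP=> c Nc Hc def_x; exists c; split=> // h Hh.
have /cycleP[a ea] : coset T h \in <[x]> by rewrite -ex mem_quotient.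
exists a, ((c ^+ a)^-1 * h); split; last by rewrite mulKVg.
have Nh : h \in 'N(T) := subsetP nTH h Hh.
apply: coset_idr; first by rewrite groupM ?groupV ?groupX.
by rewrite morphM ?groupV ?groupX // morphV ?groupX // morphX //= ea def_x mulVg.
Qed.

Section Generator.
Variable c : gT.
Hypothesis gen_c : gen_mod c.

Let Hc : c \in H. Proof. by case: gen_c. Qed.

(** If [<[c]>] met T nontrivially it would contain T, which has prime order, and H would equal
    [<[c]>]. *)
Lemma gen_mod_TI i : c ^+ i \in T -> c ^+ i = 1.
Proof.
move=> Tci; apply/eqP; apply: contraNT ncH => nt.
have pT : prime #|T| by rewrite oT.
apply/cyclicP; exists c; apply/eqP; rewrite eqEsubset cycle_subG Hc andbT.
have sTc : T \subset <[c]>.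
  apply: contraR nt => h; have := prime_TIg pT h.
  by move/setP/(_ (c ^+ i)); rewrite !inE Tci mem_cycle => /esym.
apply/subsetP=> h Hh; have [a [t [Tt ->]]] := gen_c.2 h Hh.
by rewrite groupM ?mem_cycle ?(subsetP sTc).
Qed.

Lemma gen_mod_uniq i j t u : t \in T -> u \in T ->
  c ^+ i * t = c ^+ j * u -> c ^+ i = c ^+ j /\ t = u.
Proof.
move=> Tt Tu; wlog lij : i j t u Tt Tu / i <= j => [IH e|].
  have [le|/ltnW le] := leqP i j; first exact: IH.
  by have [-> ->] := IH _ _ _ _ Tu Tt le (esym e).
rewrite -(subnKC lij) expgD -mulgA => /mulgI e.
have c1 : c ^+ (j - i) = 1.
  by apply: gen_mod_TI; rewrite -(groupMr _ Tu) -e.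
by move: e; rewrite c1 mul1g mulg1.
Qed.

Lemma gen_mod_order : #[c] = (p ^ k)%N.
Proof.
have Nc : c \in 'N(T) := subsetP nTH c Hc.
have defHT : H / T = <[coset T c]>.
  apply/eqP; rewrite eqEsubset cycle_subG mem_quotient // andbT.
  apply/subsetP=> _ /morphimP[h Nh Hh ->]; have [a [t [Tt ->]]] := gen_c.2 h Hh.
  have Nt : t \in 'N(T) := subsetP nTH t (TH Tt).
  by rewrite morphM ?groupX // morphX //= (coset_id Tt) mulg1 mem_cycle.
rewrite -oHT defHT -orderE.
apply/eqP; rewrite eqn_dvd order_dvdn.
have -> : c ^+ #[coset T c] = 1.
  apply: gen_mod_TI; apply: coset_idr; first exact: groupX.
  by rewrite morphX //= expg_order.
by rewrite eqxx morph_order.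
Qed.

Lemma gen_mod_X i j : (c ^+ i == c ^+ j) = (i == j %[mod p ^ k]).
Proof. by rewrite eq_expg_mod_order gen_mod_order. Qed.

Lemma index_gt0 : 0 < k.
Proof.
rewrite lt0n; apply: contraNneq ncH => k0; move/eqP: oHT; rewrite k0 expn0 -trivg_card1.
rewrite -subG1 quotient_sub1 // => sHT; apply: cyclicS sHT _.
by apply: prime_cyclic; rewrite oT.
Qed.

Lemma gen_mod_N i t : t \in T -> (c ^+ i * t \in N) = (p %| i) && (t == 1).
Proof.
move=> Tt; rewrite -[gval N]/(gval N) NE; apply/imsetP/andP.
  case=> h Hh; have [a [u [Tu ->]]] := gen_c.2 h Hh.
  have Ha : c ^+ a \in H by apply: groupX.
  rewrite (XM _ Ha (TH Tu)) (Tp Tu) -expgM => e.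
  have [e1 ->] := gen_mod_uniq Tt (group1 T) e; split=> //.
  move/eqP: e1.
  have pk : p %| p ^ k by rewrite -[X in X %| _]expn1 dvdn_exp2l // index_gt0.
  rewrite gen_mod_X => /eqP ea.
  by rewrite /dvdn -(modn_dvdm i pk) ea modn_dvdm // modnMl.
case=> /dvdnP[a ->] /eqP->; exists (c ^+ a); first exact: groupX.
by rewrite mulg1 expgM.
Qed.

Lemma gen_mod_B i t : t \in T -> (c ^+ i * t \in B) = (p %| i).
Proof.
move=> Tt; rewrite (groupMr _ (subsetP sTB t Tt)).
apply/idP/idP=> [|pi]; last first.
  by apply: (subsetP sNB); rewrite -[c ^+ i]mulg1 gen_mod_N // pi eqxx.
rewrite /B /= norm_joinEr; last by rewrite (subset_trans sNH).
case/mulsgP=> u n Tu Nn e.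
have : c ^+ i * u^-1 \in N.
  rewrite e (cHH (TH Tu) (subsetP sNH n Nn)) mulgK; exact: Nn.
by rewrite gen_mod_N ?groupV // => /andP[].
Qed.

End Generator.

Lemma notin_B_gen_mod c : c \in H -> c \notin B -> gen_mod c.
Proof.
have [c0 gen0] := gen_mod_exists; move=> Hc Bc; split=> // h Hh.
have [i [t [Tt ec]]] := gen0.2 c Hc; have [j [u [Tu eh]]] := gen0.2 h Hh.
move: Bc; rewrite ec gen_mod_B // => npi.
have co : coprime i (p ^ k) by rewrite coprime_sym coprimeXl // prime_coprime.
have Hc0 : c0 \in H := gen0.1.
have [a ea] : exists a, c0 ^+ j = c0 ^+ (i * a).
  have := generator_coprime c0 i; rewrite gen_mod_order // coprime_sym co => /eqP e.
  have : c0 ^+ j \in <[c0 ^+ i]> by rewrite -e mem_cycle.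
  by case/cycleP=> a ->; exists a; rewrite expgM.
exists a, ((t ^+ a)^-1 * u); rewrite groupM ?groupV ?groupX //; split=> //.
rewrite XM ?groupX // ?TH // -expgM -ea eh -mulgA; congr (_ * _).
by rewrite mulKVg.
Qed.

Lemma card_derived_quotient : #|H / N| = (p ^ 2)%N /\ ~~ cyclic (H / N).
Proof.
have [c gen_c] := gen_mod_exists; have Hc := gen_c.1.
split; last first.
  apply: contraNN ncH => cyc; have := @Phi_quotient_cyclic _ H.
  by rewrite (Phi_Mho pH abH); apply.
have Ncp : N :=: <[c ^+ p]>.
  have Ncp : c ^+ p \in N by apply: Np.
  apply/eqP; rewrite eqEsubset cycle_subG Ncp andbT.
  apply/subsetP=> h Nh; have [a [t [Tt eh]]] := gen_c.2 h (subsetP sNH h Nh).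
  move: Nh; rewrite eh gen_mod_N // => /andP[/dvdnP[b ->] /eqP->].
  by rewrite mulg1 mulnC expgM mem_cycle.
have cH : (#|H| = p ^ k * p)%N by rewrite -(Lagrange sTH) oT -card_quotient // oHT mulnC.
rewrite card_quotient ?(normal_norm (char_normal charN)) // -divgS // cH Ncp -orderE.
rewrite orderXdiv ?gen_mod_order //; last by rewrite -{1}[p]expn1 dvdn_exp2l // index_gt0.
have -> : (p ^ k = p * p ^ k.-1)%N by rewrite -expnS prednK // index_gt0.
by rewrite mulKn ?prime_gt0 // mulnAC mulnn mulnK // expn_gt0 prime_gt0.
Qed.

(** Among the commutators [c ^+ (p ^ j.+1) * t], a power relation has exponent r prime to p because
    [t ^+ r = t], so the valuations would agree. Only exponents divisible by p are asked for, since
    [inverting_action_bound] supplies only even ones. *)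
Lemma coset_comm_bound c t : gen_mod c -> t \in T -> t != 1 ->
    (forall e, p %| e -> exists u v, [/\ u \in G, v \in G & c ^+ e * t = [~ u, v]]) ->
  k <= m.+1.
Proof.
move=> gen_c Tt ntt comm; have Hc := gen_c.1; rewrite leqNgt; apply/negP=> ltk.
have [i _|i [j [/andP[ltij lejm] ij]]] :=
    comm_cover_pigeon p_pr pG cov (f := fun j => c ^+ (p ^ j.+1) * t).
  by apply: comm; rewrite expnS dvdn_mulr.
have tX r : ~~ (p %| r) || (t ^+ r != t).
  case: (boolP (p %| r)) => //= /dvdnP[q ->].
  by rewrite mulnC expgM Tp // expg1n eq_sym.
have key a b r : c ^+ (p ^ a.+1) * t = (c ^+ (p ^ b.+1) * t) ^+ r ->
    a < k -> b < k -> (p ^ a.+1 = p ^ b.+1 * r %[mod p ^ k])%N /\ ~~ (p %| r).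
  move=> + _ _; rewrite XM ?groupX // ?TH // -expgM => e.
  have [/eqP + tr] := gen_mod_uniq gen_c Tt (groupX r Tt) e.
  rewrite gen_mod_X // => /eqP ->; split=> //.
  by have := tX r; rewrite -tr eqxx orbF.
have ltjk : j < k by apply: leq_trans ltk; rewrite ltnS (leq_trans lejm).
have ltik : i < k by apply: ltn_trans ltjk.
have pi2 : p ^ i.+2 %| p ^ k.
  by rewrite dvdn_exp2l // (leq_trans _ ltjk).
have pj2 : p ^ i.+2 %| p ^ j.+1 by rewrite dvdn_exp2l.
have modE a b : a = b %[mod p ^ k] -> p ^ i.+2 %| a -> p ^ i.+2 %| b.
  by move=> e; rewrite /dvdn -(modn_dvdm a pi2) e modn_dvdm.
have pi1 r : p ^ i.+2 %| p ^ i.+1 * r = (p %| r).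
  by rewrite [(p ^ i.+2)%N]expnSr dvdn_pmul2l ?expn_gt0 ?prime_gt0.
case: ij => /cycleP[r /key[]] // e npr.
  have := modE _ _ (esym e) (dvdn_mulr r pj2).
  by rewrite -[(p ^ i.+1)%N]muln1 pi1 dvdn1; case: (p) p_pr => [|[|]].
by have := modE _ _ e pj2; rewrite pi1 (negbTE npr).
Qed.

(** All [[~ g * x ^+ n, y]] have the same component t in T, and by [affine_orbit_onto] their
    exponents of c take every value modulo [p ^ k]. *)
Lemma cyclic_action_bound x y g a : x \in G -> y \in G -> g \in G ->
    gen_mod [~ x, y] -> [~ x, y] ^ x = [~ x, y] ^+ (1 + p * a) ->
    (p = 2 -> 2 %| a) -> [~ g, y] \notin <[[~ x, y]]> ->
  k <= m.+1.
Proof.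
move=> Gx Gy Gg; have [c dc] : exists c, c = [~ x, y] by exists [~ x, y].
rewrite -dc => gen_c cx p2 ngy; have Hc := gen_c.1; set l := (1 + p * a)%N in cx.
have cxX n : c ^ (x ^+ n) = c ^+ (l ^ n).
  elim: n => [|n IH]; first by rewrite expg0 conjg1 expn0 expg1.
  by rewrite expgS conjgM cx conjXg IH -expgM expnSr.
have xnE n : [~ x ^+ n, y] = c ^+ (geom_sum l n).
  elim: n => [|n IH]; first by rewrite /geom_sum big_ord0 expg0 comm1g.
  by rewrite expgS commMgJ IH -dc cxX geom_sumS -expgD addnC.
have [i [t [Tt egy]]] := gen_c.2 _ (HR Gg Gy).
have ntt : t != 1 by apply: contraNneq ngy => t1; rewrite egy t1 mulg1 mem_cycle.
apply: (coset_comm_bound gen_c Tt ntt) => e _.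
have [n en] := affine_orbit_onto k i e p_pr p2.
exists (g * x ^+ n), y; rewrite groupM ?groupX //; split=> //.
rewrite commMgJ egy xnE conjMg conjXg cxX (JT Tt (groupX n Gx)) -expgM.
rewrite -mulgA -(cHH (groupX _ Hc) (TH Tt)) mulgA -expgD mulnC; congr (_ * _).
by apply/eqP; rewrite eq_sym gen_mod_X // /l en.
Qed.

(** As z acts on [<[c]>] by an exponent 3 modulo 4, [[~ c, z]] generates the squares of [<[c]>];
    hence the [[~ u * c ^+ j, z]] reach every even exponent with the fixed component t. *)
Lemma inverting_action_bound c z u a b t : p = 2 -> gen_mod c -> z \in G -> u \in G ->
    [~ c, z] = c ^+ (2 * a) -> odd a ->
    [~ u, z] = c ^+ (2 * b) * t -> t \in T -> t != 1 ->
  k <= m.+1.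
Proof.
move=> p2 gen_c Gz Gu cz odda uz Tt ntt; have Hc := gen_c.1.
apply: (coset_comm_bound gen_c Tt ntt) => e; rewrite p2 => /dvdnP[e' ->].
have : c ^+ (2 * e') * (c ^+ (2 * b))^-1 \in <[c ^+ (2 * a)]>.
  rewrite [c ^+ (2 * a)]expgM; have := generator_coprime (c ^+ 2) a.
  have -> : coprime #[c ^+ 2] a.
    apply: (@coprime_dvdl _ (2 ^ k)); last by rewrite coprimeXl // coprime2n.
    by rewrite order_dvdn -expgM mulnC expgM -{1}p2 -(gen_mod_order gen_c) expg_order expg1n.
  by move/eqP <-; rewrite !expgM groupM ?groupV ?mem_cycle.
case/cycleP=> j ej; exists (u * c ^+ j), z.
have Gcj : c ^+ j \in G by rewrite groupX // (subsetP sHG).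
rewrite groupM //; split=> //; rewrite commMgJ uz conjMg (JT Tt Gcj).
rewrite (JH (groupX (2 * b) Hc) (groupX j Hc)) commXg; last first.
  by apply: (cHH Hc); rewrite cz; apply: groupX.
have Hd : c ^+ (2 * e') * (c ^+ (2 * b))^-1 \in H by rewrite groupM ?groupV ?groupX.
rewrite cz -ej -mulgA (cHH (TH Tt) Hd) mulgA; congr (_ * _).
by rewrite mulgA (cHH (groupX (2 * b) Hc) (groupX (2 * e') Hc)) mulgK mulnC.
Qed.

(** B has index p in H, and a p-group centralises a normal section of order p. *)
Lemma comm_sub_B : [~: H, G] \subset B.
Proof.
have [c gen_c] := gen_mod_exists; have Hc := gen_c.1.
have nsBG : B <| G.
  by rewrite /normal (subset_trans sBH sHG) normsY // normal_norm.
have nBG := normal_norm nsBG.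
have Bc : c \notin B.
  rewrite -[c]expg1 -[c ^+ 1]mulg1 gen_mod_B // dvdn1.
  by case: (p) p_pr => [|[|]].
have ntHB : H / B != 1.
  by apply: contra Bc; rewrite -subG1 (quotient_sub1 (subset_trans sHG nBG)) => /subsetP; apply.
have pGB : p.-group (G / B) by apply: quotient_pgroup.
have nsHB : H / B <| G / B by apply: quotient_normal; apply: der_normal.
have := meet_center_nil (pgroup_nil pGB) nsHB ntHB.
have prHB : prime #|H / B|.
  have -> : H / B = <[coset B c]>.
    apply/eqP; rewrite eqEsubset cycle_subG mem_quotient // andbT.
    apply/subsetP=> _ /morphimP[h Nh Hh ->]; have [i [t [Tt ->]]] := gen_c.2 h Hh.
    have NB z : z \in H -> z \in 'N(B) by move=> Hz; apply: (subsetP nBG); apply: (subsetP sHG).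
    rewrite (morphM _ (NB _ (groupX i Hc)) (NB _ (TH Tt))) /=.
    by rewrite (morphX _ _ (NB _ Hc)) /= (coset_id (subsetP sTB t Tt)) mulg1 mem_cycle.
  have NBc : c \in 'N(B) := subsetP (subset_trans sHG nBG) c Hc.
  rewrite -orderE (nt_prime_order p_pr) //.
    by rewrite -(morphX _ _ NBc) /= coset_id // (subsetP sNB) // Np.
  by apply: contraNneq Bc => /(coset_idr NBc).
rewrite -(quotient_cents2 (subset_trans sHG nBG) nBG) => nt.
have sHZ : H / B \subset 'Z(G / B).
  by apply: contraR nt => ns; rewrite (prime_TIg prHB ns).
by apply: subset_trans sHZ (subsetIr _ _).
Qed.

Lemma comm_gen_X c i t z : t \in T -> z \in G -> c \in H ->
  [~ c ^+ i * t, z] = [~ c, z] ^+ i.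
Proof.
move=> Tt Gz Hc; have Hcz : [~ c, z] \in H by apply: HRl.
rewrite commMgJ commXg; last by apply: (cHH Hc).
have -> : [~ t, z] = 1.
  by apply/eqP/commgP; rewrite /commute conjgC (JT Tt Gz).
by rewrite mulg1 (JH (groupX i Hcz) (TH Tt)).
Qed.

Lemma comm_in_N c z : gen_mod c -> z \in G -> [~ c, z] \in N ->
  exists a, [~ c, z] = c ^+ (p * a) /\ c ^ z = c ^+ (1 + p * a).
Proof.
move=> gen_c Gz; have Hc := gen_c.1.
have [i [t [Tt e]]] := gen_c.2 _ (HRl Hc Gz).
rewrite e gen_mod_N // => /andP[/dvdnP[a ea] /eqP t1]; exists a.
by rewrite conjg_mulR e t1 ea mulg1 mulnC expgD expg1.
Qed.

Lemma comm_B_N b z : b \in B -> z \in G -> [~ b, z] \in N.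
Proof.
rewrite /B /= norm_joinEr ?(subset_trans sNH nTH) // => /mulsgP[t n Tt Nn ->] Gz.
have nNz : n ^ z \in N by rewrite memJ_norm // (subsetP (normal_norm nsNG)).
by rewrite commgEl invMg conjMg (JT Tt Gz) mulgA -(mulgA _ _ t) mulVg mulg1 groupM ?groupV.
Qed.

(** x acts on [<[c]>] by a power map, and [[~ c, v]] has a nontrivial component in T, so c itself
    can serve as g in [cyclic_action_bound]. *)
Lemma twisted_bound x v : x \in G -> v \in G -> [~ x, v] \notin B ->
    [~ [~ x, v], v] \notin N -> [~ [~ x, v], x] \in N ->
  k <= m.+1.
Proof.
move=> Gx Gv; have [c dc] : exists c, c = [~ x, v] by exists [~ x, v].
rewrite -dc => Bc ncv Ncx; have Hc : c \in H by rewrite dc HR.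
have gen_c := notin_B_gen_mod Hc Bc.
have [a [ea cx]] := comm_in_N gen_c Gx Ncx.
have [i [t [Tt ecv]]] := gen_c.2 _ (HRl Hc Gv).
have pi : p %| i.
  by rewrite -(gen_mod_B gen_c i Tt) -ecv (subsetP comm_sub_B) ?mem_commg.
have ntt : t != 1 by move: ncv; rewrite ecv gen_mod_N // pi.
have [/implyP p2 | ] := boolP ((p == 2) ==> (2 %| a)).
  apply: (@cyclic_action_bound x v c a); rewrite -?dc //.
  - exact: (subsetP sHG).
  - by move/eqP.
  apply: contra ntt => /cycleP[j]; rewrite ecv -[c ^+ j]mulg1 => e.
  by have [_ ->] := gen_mod_uniq gen_c Tt (group1 T) e.
rewrite negb_imply dvdn2 negbK => /andP[/eqP p2 odda].
have [i' ei] : exists i', i = (2 * i')%N.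
  by move: pi; rewrite p2 => /dvdnP[i' ->]; exists i'; rewrite mulnC.
have cV n : (c ^+ n)^-1 = c ^+ ((p ^ k).-1 * n).
  apply/eqP; rewrite eq_invg_mul -expgD -mulSn prednK ?expn_gt0 ?prime_gt0 //.
  by rewrite expgM -(gen_mod_order gen_c) expg_order expg1n.
(* [[~ v, x]] is the inverse of c, with odd exponent and no component in T; passing to [v * v] gives
   an even exponent and the component [t^-1]. *)
apply: (@inverting_action_bound c x (v * v) a ((p ^ k).-1 * i'.+1)%N t^-1) => //.
- by rewrite groupM.
- by rewrite ea p2.
- rewrite commMgJ -[[~ v, x]]invg_comm -dc conjVg -invMg conjg_mulR ecv.
  have -> : c * (c * (c ^+ i * t)) = c ^+ (2 * i'.+1) * t.
    by rewrite mulnS (expgD c 2) ei !mulgA.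
  rewrite invMg cV (cHH (groupVr (TH Tt)) (groupX _ Hc)); congr (c ^+ _ * _).
  by rewrite mulnCA.
- by rewrite groupV.
by rewrite invg_eq1.
Qed.

Let BE b : b \in B -> exists t n, [/\ t \in T, n \in N & b = t * n].
Proof.
rewrite /B /= norm_joinEr ?(subset_trans sNH nTH) // => /mulsgP[t n Tt Nn ->].
by exists t, n.
Qed.
Let cycT t : t \in T -> t != 1 -> forall u, u \in T -> u \in <[t]>.
Proof.
move=> Tt ntt u Tu; have: T :&: <[t]> != 1.
  by apply: contraNneq ntt => e; apply/eqP/set1gP; rewrite -e inE Tt cycle_id.
have pT : prime #|T| by rewrite oT.
by apply: contraR => nu; rewrite (prime_TIg pT) //; apply: contra nu => /subsetP; apply.
Qed.
Let p_dvd1 : (p %| 1) = false.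
Proof. by rewrite dvdn1; case: (p) p_pr => [|[|]]. Qed.

Lemma indep_mod_notin_B c d : indep_mod p N c d -> c \in B -> d \notin B.
Proof.
move=> ind Bc; apply/negP => Bd.
have [t1 [n1 [Tt1 Nn1 ec]]] := BE Bc; have [t2 [n2 [Tt2 Nn2 ed]]] := BE Bd.
have [Hn1 Hn2] := (subsetP sNH n1 Nn1, subsetP sNH n2 Nn2).
have [t11 | ntt] := eqVneq t1 1.
  by have := ind 1%N 0; rewrite expg1 mulg1 ec t11 mul1g p_dvd1 => /(_ Nn1).
have /cycleP[j ej] := cycT Tt1 ntt Tt2.
suff Ncd : c ^+ (p.-1 * j) * d \in N.
  by have := ind (p.-1 * j)%N 1%N; rewrite p_dvd1 andbF expg1 => /(_ Ncd).
rewrite ec ed ej XM // ?TH // -mulgA (mulgA (n1 ^+ _)).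
rewrite (cHH (groupX _ Hn1) (groupX j (TH Tt1))) !mulgA -expgD -mulSnr.
rewrite prednK ?prime_gt0 // expgM Tp // expg1n mul1g.
by rewrite groupM ?groupX.
Qed.

(** Modulo N, [[~ c, x]] and [[~ c, v]] are elements t1 and t2 of T with t2 nontrivial. Replacing x
    by [x * v ^+ j], where [t2 ^+ j = t1^-1], moves [[~ c, x]] into N and changes [[~ x, v]] only by
    a factor in B; this is the situation of [twisted_bound]. *)
Lemma twisted_branch x v e : x \in G -> v \in G -> e \in H ->
  indep_mod p N [~ x, v] [~ e, v] -> k <= m.+1.
Proof.
move=> Gx Gv He; have [c dc] : exists c, c = [~ x, v] by exists [~ x, v].
rewrite -dc => ind; have Hc : c \in H by rewrite dc HR.
have inB h z : h \in H -> z \in G -> [~ h, z] \in B.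
  by move=> Hh Gz; apply: (subsetP comm_sub_B); apply: mem_commg.
have Bc : c \notin B by apply: contraL (inB e v He Gv); apply: indep_mod_notin_B.
have gen_c := notin_B_gen_mod Hc Bc.
have ncv : [~ c, v] \notin N.
  apply/negP=> Ncv; have := ind 0 1%N; rewrite expg0 mul1g expg1 p_dvd1 andbF.
  have [i [t [Tt ->]]] := gen_c.2 e He.
  by rewrite comm_gen_X // groupX // => /(_ isT).
have [t1 [n1 [Tt1 Nn1 ex]]] := BE (inB c x Hc Gx).
have [t2 [n2 [Tt2 Nn2 ev]]] := BE (inB c v Hc Gv).
have ntt2 : t2 != 1 by apply: contraNneq ncv => t21; rewrite ev t21 mul1g.
have /cycleP[j ej] := cycT Tt2 ntt2 (groupVr Tt1).
have nN z n : z \in G -> n \in N -> n ^ z \in N.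
  by move=> Gz Nn; rewrite memJ_norm // (subsetP (normal_norm nsNG)).
have HN n : n \in N -> n \in H by apply: subsetP.
have cvX r : exists2 n, n \in N & [~ c, v ^+ r] = t2 ^+ r * n.
  elim: r => [|r [n Nn IH]]; first by exists 1; rewrite // expg0 commg1 mulg1.
  exists (n2 * n ^ v); first by rewrite groupM ?nN.
  rewrite expgSr commgMJ IH ev conjMg (JT (groupX r Tt2) Gv) expgS -!mulgA.
  by congr (_ * _); rewrite !mulgA (cHH (HN _ Nn2) (TH (groupX r Tt2))).
have [n Nn evj] := cvX j.
have Gvj : v ^+ j \in G by rewrite groupX.
have Gx' : x * v ^+ j \in G by rewrite groupM.
have Bb := inB c (v ^+ j) Hc Gvj.
have ec' : [~ x * v ^+ j, v] = c * [~ c, v ^+ j].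
  have -> : [~ x * v ^+ j, v] = c ^ (v ^+ j).
    rewrite commMgJ -dc; have -> : [~ v ^+ j, v] = 1; last by rewrite mulg1.
    by apply/eqP/commgP; apply: commute_sym; apply: commuteX.
  by rewrite conjg_mulR.
have redN z : z \in G -> ([~ c * [~ c, v ^+ j], z] \in N) = ([~ c, z] \in N).
  move=> Gz; rewrite commMgJ (JH (HRl Hc Gz) (subsetP sBH _ Bb)).
  by rewrite (groupMr _ (comm_B_N Bb Gz)).
apply: (@twisted_bound (x * v ^+ j) v) => //; rewrite ec'.
- by rewrite groupMr.
- by rewrite redN.
rewrite redN // commgMJ evj ex conjMg (JT Tt1 Gvj) -ej.
have := nN _ _ Gvj Nn1; move: (n1 ^ _) => w Nw.
rewrite -mulgA (mulgA n) (cHH (HN n Nn) (TH Tt1)) !mulgA mulVg mul1g.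
exact: groupM.
Qed.

Section CentralAction.
Hypothesis sHGN : [~: H, G] \subset N.

Let HN n : n \in N -> n \in H. Proof. exact: subsetP. Qed.
Let NH h : h \in H -> h \in 'N(N).
Proof. by move=> Hh; apply: (subsetP (normal_norm nsNG)); apply: (subsetP sHG). Qed.
Let NR h z : h \in H -> z \in G -> [~ h, z] \in N.
Proof. by move=> Hh Gz; apply: (subsetP sHGN); apply: mem_commg. Qed.
Let piM a b : a \in H -> b \in H -> coset N (a * b) = coset N a * coset N b.
Proof. by move=> Ha Hb; rewrite morphM ?NH. Qed.
Let piV a : a \in H -> coset N a^-1 = (coset N a)^-1.
Proof. by move=> Ha; rewrite morphV ?NH. Qed.
Let piJ h z : h \in H -> z \in G -> coset N (h ^ z) = coset N h.
Proof.
move=> Hh Gz; have Nhz := NR Hh Gz.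
by rewrite conjg_mulR (piM Hh (HN Nhz)) (coset_id Nhz) mulg1.
Qed.
Let pi1 h : h \in H -> coset N h = 1 -> h \in N.
Proof. by move=> Hh; apply: coset_idr; apply: NH. Qed.
Let piB a b : a \in H -> b \in H -> coset N a = coset N b -> b \in B -> a \in B.
Proof.
move=> Ha Hb e Bb; rewrite -(mulgKV b a) groupMr // (subsetP sNB) //.
by apply: pi1; rewrite ?groupM ?groupV // piM ?groupV // piV // e mulgV.
Qed.

(* For p = 2 the crossed homomorphism [n |-> [x^n, y]] is onto only when [x]
   acts on [<c>] by an exponent congruent to 1 modulo 4.  Elements acting by an
   exponent congruent to 3 modulo 4 are governed by [inverting_action_bound],
   and the two facts together exclude every parity pattern of x, y, g. *)
Lemma central_two_bound x y g : p = 2 -> x \in G -> y \in G -> g \in G ->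
    [~ x, y] \notin B -> [~ g, y] \in B -> [~ g, y] \notin N ->
  k <= m.+1.
Proof.
move=> p2 Gx Gy Gg; have [c dc] : exists c, c = [~ x, y] by exists [~ x, y].
have [d dd] : exists d, d = [~ g, y] by exists [~ g, y].
rewrite -dc -dd => Bc Bd Nd; have Hc : c \in H by rewrite dc HR.
have Hd : d \in H by rewrite dd HR.
have gen_c := notin_B_gen_mod Hc Bc.
have [//|ltk] := leqP k m.+1.
(* Odd a means an exponent 3 modulo 4, handled by F; even a means 1 modulo 4, handled by A. *)
pose P z a := c ^ z = c ^+ (1 + 2 * a).
have exP z : z \in G -> exists a, P z a.
  move=> Gz; have [a [_ e]] := comm_in_N gen_c Gz (NR Hc Gz).
  by exists a; rewrite /P -p2.
have PM z w a b : P z a -> P w b -> P (z * w) (a + b + 2 * (a * b))%N.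
  rewrite /P => ez ew; rewrite conjgM ez conjXg ew -expgM; congr (_ ^+ _).
  by ring.
have piX h : h \in H -> coset N h * coset N h = 1.
  by move=> Hh; rewrite -piM // coset_id //; have := Np Hh; rewrite p2.
have F z u a : z \in G -> u \in G -> P z a -> odd a -> [~ u, z] \in B -> [~ u, z] \in N.
  move=> Gz Gu Pz odda Buz; apply: contraLR ltk => nuz; rewrite -leqNgt.
  have [i [t [Tt eu]]] := gen_c.2 _ (HR Gu Gz).
  have pi : p %| i by rewrite -(gen_mod_B gen_c i Tt) -eu.
  have ntt : t != 1 by move: nuz; rewrite eu gen_mod_N // pi.
  move: pi; rewrite p2 => /dvdnP[b eb].
  apply: (inverting_action_bound p2 gen_c Gz Gu _ odda _ Tt ntt (b := b)).
    by rewrite commgEl Pz expgD expg1 mulKg.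
  by rewrite eu eb mulnC.
have A z y' g' a : z \in G -> y' \in G -> g' \in G -> P z a -> ~~ odd a ->
    [~ z, y'] \notin B -> [~ g', y'] \in <[[~ z, y']]>.
  move=> Gz Gy' Gg' Pz eva Bzy; apply: contraLR ltk => ngy; rewrite -leqNgt.
  have gen1 := notin_B_gen_mod (HR Gz Gy') Bzy.
  have [u [t1 [Tt1 e1]]] := gen_c.2 _ (HR Gz Gy').
  have [w [t2 [Tt2 e2]]] := gen1.2 c Hc.
  have [b eb] : exists b, a = (2 * b)%N.
    by exists a./2; rewrite mul2n -[LHS]odd_double_half (negbTE eva).
  (* The action is known on c and must be read on [[~ z, y']]. Fourth powers lose their components
     in T, so the exponent stays 1 modulo 4. *)
  apply: (@cyclic_action_bound z y' g' (2 * (w * b * u))) => //; last first.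
    by move=> _; rewrite dvdn_mulr.
  have c4 : c ^+ 4 = [~ z, y'] ^+ (4 * w).
    rewrite e2 XM ?groupX ?HR ?TH //; rewrite -[4%N]/(2 * 2)%N [t2 ^+ _]expgM.
    by have := Tp Tt2; rewrite p2 => ->; rewrite expg1n mulg1 -expgM mulnC.
  rewrite {1}e1 conjMg conjXg Pz (JT Tt1 Gz) -expgM mulnDl mul1n expgD.
  rewrite -mulgA (cHH (groupX _ Hc) (TH Tt1)) mulgA -e1 expgD expg1 p2.
  congr (_ * _); rewrite eb.
  have -> : (2 * (2 * b) * u = 4 * (b * u))%N by ring.
  rewrite [c ^+ (4 * _)]expgM c4 -expgM; congr (_ ^+ _); ring.
have [ax Px] := exP x Gx; have [ag Pg] := exP g Gg; have [ay Py] := exP y Gy.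
have notcyc : d \notin <[c]>.
  apply/negP=> /cycleP[i ei]; move: Bd Nd; rewrite ei -[c ^+ i]mulg1.
  by rewrite gen_mod_B // gen_mod_N // => ->; rewrite eqxx.
have odx : odd ax.
  apply: contraR notcyc => evx; have := A x y g ax Gx Gy Gg Px evx.
  by rewrite -dc -dd; apply.
have evy : ~~ odd ay.
  apply: contra Nd => ody; have := F y g ay Gy Gg Py ody.
  by rewrite -dd; apply.
have Gxg : x * g \in G by rewrite groupM.
have Gxy : x * y \in G by rewrite groupM.
have Hcg : c ^ g \in H by rewrite nHG.
case: (boolP (odd ag)) => [odg | evg].
  (* [x * g] acts by 1 modulo 4, so A makes c a power of [[~ x * g, y]], which is [c * d] modulo N.
     As [H / N] has exponent 2 and c is not in N, this gives d in N. *)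
  have e1 : [~ x * g, y] = c ^ g * d by rewrite commMgJ -dc -dd.
  have B1 : [~ x * g, y] \notin B.
    rewrite e1 groupMr //; apply: contra Bc; apply: piB => //.
    by rewrite piJ.
  have ev : ~~ odd (ax + ag + 2 * (ax * ag)) by rewrite !oddD oddM odx odg.
  have := A _ y x _ Gxg Gy Gx (PM _ _ _ _ Px Pg) ev B1; rewrite -dc => /cycleP[r er].
  have H1 : [~ x * g, y] \in H by rewrite HR.
  have pi_r : coset N c = coset N [~ x * g, y] ^+ r by rewrite {1}er morphX ?NH.
  have pi2s n : coset N [~ x * g, y] ^+ (2 * n) = 1.
    by rewrite expgM [_ ^+ 2]piX // expg1n.
  have er2 := odd_double_half r; move: pi_r; rewrite -er2 -mul2n expgD pi2s mulg1.
  case: (odd r) => /= pi_c; last by case/negP: Bc; rewrite (subsetP sNB) ?pi1.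
  case/negP: Nd; apply: pi1 => //; apply: (mulgI (coset N c)).
  by rewrite mulg1 [in RHS]pi_c expg1 e1 piM // piJ.
have [Hq Hd'] : [~ g, x] \in H /\ d^-1 \in H by rewrite HR // groupV.
have Hc' : c^-1 \in H by rewrite groupV.
case: (boolP ([~ g, x] \in B)) => Bq.
  (* Then [[~ g, x * y]] is d modulo N, although [x * y] acts by 3 modulo 4, contrary to F. *)
  have Nq := F x g ax Gx Gg Px odx Bq.
  have Nqy : [~ g, x] ^ y \in N by rewrite memJ_norm // (subsetP (normal_norm nsNG)).
  have eq : [~ g, x * y] = d * [~ g, x] ^ y by rewrite commgMJ -dd.
  have od : odd (ax + ay + 2 * (ax * ay)) by rewrite !oddD oddM odx (negbTE evy).
  have := F _ g _ Gxy Gg (PM _ _ _ _ Px Py) od.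
  rewrite eq (groupMr d (subsetP sNB _ Nqy)) (groupMr d Nqy) (negbTE Nd).
  by move/(_ Bd).
(* F for [[~ y * g, x]] now shows that [[~ g, x]] is c modulo N. Hence [[~ x * y, x * g]] is [d^-1]
   modulo N, contrary to F for [x * g], which acts by 3 modulo 4. *)
have eq1 : [~ y * g, x] = (c ^ g)^-1 * [~ g, x].
  by rewrite commMgJ -[[~ y, x]]invg_comm -dc conjVg.
have Nq1 : (c ^ g)^-1 * [~ g, x] \in N.
  rewrite -eq1; apply: (F x (y * g) ax) => //; first by rewrite groupM.
  rewrite eq1; have [j [t [Tt ej]]] := gen_c.2 _ Hq.
  move: Bq; rewrite ej gen_mod_B // p2 dvdn2 negbK => oj.
  have Hjt : c ^+ j * t \in H by rewrite groupM ?groupX // TH.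
  apply: (@piB _ (c^-1 * (c ^+ j * t)) (groupM (groupVr Hcg) Hjt) (groupM Hc' Hjt)).
    by rewrite (piM (groupVr Hcg) Hjt) (piM Hc' Hjt) (piV Hcg) (piV Hc) (piJ Hc Gg).
  rewrite -(odd_double_half j) oj expgD expg1 -mulgA mulKg gen_mod_B // p2.
  by rewrite -mul2n dvdn_mulr.
have pi_q : coset N [~ g, x] = coset N c.
  apply: (mulgI (coset N (c ^ g)^-1)).
  by rewrite -(piM (groupVr Hcg) Hq) (coset_id Nq1) (piV Hcg) (piJ Hc Gg) mulVg.
have eq2 : [~ x * y, x * g] = ([~ g, x]^-1) ^ y * (d^-1 * (c ^ g)^-1).
  rewrite commMgJ !commgMJ commgg conj1g mulg1 invg_comm; congr (_ * _).
  by rewrite dd dc -!conjVg !invg_comm.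
have pi_X : coset N [~ x * y, x * g] = coset N d^-1.
  have Hq' := groupVr Hq; have Hcg' := groupVr Hcg.
  rewrite eq2 (piM (nHG Gy Hq') (groupM Hd' Hcg')) (piM Hd' Hcg') (piJ Hq' Gy).
  rewrite (piV Hq) (piV Hcg) (piJ Hc Gg) pi_q -(piV Hc) -(piM Hd' Hc').
  by rewrite (cHH Hd' Hc') (piM Hc' Hd') mulgA (piX _ Hc') mul1g.
have H2 : [~ x * y, x * g] \in H by rewrite HR.
have BX : [~ x * y, x * g] \in B by apply: (piB H2 Hd' pi_X); rewrite groupV.
have od : odd (ax + ag + 2 * (ax * ag)) by rewrite !oddD oddM odx (negbTE evg).
have NX := F _ (x * y) _ Gxg Gxy (PM _ _ _ _ Px Pg) od BX.
case/negP: Nd; rewrite -groupV; apply: pi1 => //.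
by rewrite -pi_X coset_id.
Qed.

Lemma central_bound x y g : x \in G -> y \in G -> g \in G ->
    [~ x, y] \notin B -> indep_mod p N [~ x, y] [~ g, y] ->
  k <= m.+1.
Proof.
move=> Gx Gy Gg; have [c dc] : exists c, c = [~ x, y] by exists [~ x, y].
have [d dd] : exists d, d = [~ g, y] by exists [~ g, y].
rewrite -dc -dd => Bc ind; have Hc : c \in H by rewrite dc HR.
have Hd : d \in H by rewrite dd HR.
have gen_c := notin_B_gen_mod Hc Bc.
have notcyc : d \notin <[c]>.
  apply/negP=> /cycleP[i ei]; have := ind ((p ^ k).-1 * i)%N 1%N.
  rewrite p_dvd1 andbF expg1 ei -expgD -mulSnr prednK ?expn_gt0 ?prime_gt0 //.
  by rewrite expgM -(gen_mod_order gen_c) expg_order expg1n group1 => /(_ isT).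
have [a [_ cx]] := comm_in_N gen_c Gx (NR Hc Gx).
have [/implyP p2 | ] := boolP ((p == 2) ==> (2 %| a)).
  by apply: (@cyclic_action_bound x y g a); rewrite -?dc -?dd // => /eqP.
rewrite negb_imply => /andP[/eqP p2 _].
have Nd : d \notin N.
  by apply/negP=> Nd; have := ind 0 1%N; rewrite mul1g expg1 p_dvd1 andbF => /(_ Nd).
case: (boolP (d \in B)) => Bd.
  by apply: (@central_two_bound x y g); rewrite -?dc -?dd.
(* With d outside B, g is replaced by [x * g]: [[~ x * g, y]] is [c * d] modulo N, and a product of
   two elements outside a subgroup of index 2 lies inside it. *)
have Ncd : c * d \notin N.
  by apply/negP=> Ncd; have := ind 1%N 1%N; rewrite !expg1 p_dvd1 => /(_ Ncd).
have e1 : [~ x * g, y] = c ^ g * d by rewrite commMgJ -dc -dd.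
have Hcg : c ^ g \in H by rewrite nHG.
have e2 : coset N (c ^ g * d) = coset N (c * d) by rewrite (piM Hcg Hd) (piM Hc Hd) (piJ Hc Gg).
apply: (@central_two_bound x y (x * g) p2 Gx Gy (groupM Gx Gg)); rewrite ?e1.
- by rewrite -dc.
- apply: (piB (groupM Hcg Hd) (groupM Hc Hd) e2).
  have [i [t [Tt ei]]] := gen_c.2 d Hd; move: Bd.
  by rewrite ei gen_mod_B // mulgA -expgS gen_mod_B // p2 !dvdn2 /= negbK.
apply: contra Ncd => Ncgd; apply: pi1; first by rewrite groupM.
by rewrite -e2 coset_id.
Qed.

End CentralAction.

Lemma cyclic_by_prime_bound : k <= m.+1.
Proof.
have [oHN ncHN] := card_derived_quotient.
have [[sHGN [x [y [g [Gx Gy Gg ind]]]]] | [x [v [e [B' [[Gx Gv He ind] _]]]]]] :=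
  der1_quotient_dichotomy p_pr pG nsNG oHN ncHN; last first.
  exact: twisted_branch ind.
have [Hc Hd] : [~ x, y] \in H /\ [~ g, y] \in H by rewrite !HR.
(* Two independent commutators cannot both lie in B, whose image in [H / N] is a line; the one
   outside takes the part of c. *)
case: (boolP ([~ x, y] \in B)) => Bc; last exact: central_bound ind.
apply: (central_bound sHGN Gg Gy Gx); first exact: indep_mod_notin_B ind Bc.
move=> i j; rewrite (cHH (groupX i Hd) (groupX j Hc)) andbC; exact: ind.
Qed.

(** In a plane over the field with p elements, the points of an affine line missing the origin lie
    on different lines through it; with m < p, the values i = 0, ..., m give m + 1 of them. *)
Lemma indep_mod_commutators_bound c d (f : nat -> gT) : c \in H -> d \in H ->
    indep_mod p N c d ->
    (forall i, exists x y, [/\ x \in G, y \in G & f i = [~ x, y]]) ->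
    (forall i, coset N (f i) = coset N c * coset N d ^+ i) ->
  p <= m.
Proof.
move=> Hc Hd ind fc fE; rewrite leqNgt; apply/negP=> ltmp.
have NH h : h \in H -> h \in 'N(N).
  by move=> Hh; apply: (subsetP (normal_norm nsNG)); apply: (subsetP sHG).
have abHN : abelian (H / N) by apply: quotient_abelian.
have expHN h : h \in H / N -> h ^+ (p ^ 1) = 1.
  by case/morphimP=> h' Nh' Hh' ->; rewrite -morphX //= coset_id // Np.
have lowHN h : h \in H / N -> h ^+ (p ^ 0) = 1 -> h \in [1 coset_of N].
  by rewrite expg1 => _ ->; apply: set11.
have indN : indep_mod p [1 coset_of N] (coset N c) (coset N d).
  move=> i j; rewrite -!morphX ?NH //= -morphM ?groupX ?NH //= => /set1gP e.
  by apply: ind; apply: coset_idr; rewrite ?groupM ?groupX ?NH.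
have inj a a' b b' := indep_mod_inj p_pr (ltn0Sn 0) abHN expHN lowHN
  (mem_quotient N Hc) (mem_quotient N Hd) indN (a := a) (b := b) (a' := a') (b' := b') (l := 0).
have Hf i : f i \in H by have [x [y [Gx Gy ->]]] := fc i; apply: HR.
have key i j r : f i = f j ^+ r -> i = j * r %[mod p] /\ 1 = r %[mod p].
  move=> e; have : coset N (f i) = coset N (f j) ^+ r by rewrite e morphX ?NH.
  rewrite !fE expgMn; last first.
    by apply: (centsP abHN); rewrite ?groupX ?mem_quotient.
  rewrite -expgM -{1}[coset N c]expg1 => {}e.
  by have [|e1 e2] := inj 1%N r i (j * r)%N; rewrite ?expg1 // -[p]expn1.
have [i _|i [j [/andP[ltij lejm] ij]]] := comm_cover_pigeon p_pr pG cov (f := f).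
  exact: fc.
have eqij : i = j %[mod p].
  case: ij => /cycleP[r /key[e1 e2]]; [|symmetry]; by rewrite e1 -modnMmr -e2 modnMmr muln1.
move: eqij; rewrite !modn_small ?(leq_ltn_trans lejm) // ?(ltn_trans ltij) ?(leq_ltn_trans lejm) //.
by move=> e; rewrite e ltnn in ltij.
Qed.

Lemma prime_cover_bound : p <= m.
Proof.
have [oHN ncHN] := card_derived_quotient.
have NH h : h \in H -> h \in 'N(N).
  by move=> Hh; apply: (subsetP (normal_norm nsNG)); apply: (subsetP sHG).
have [[sHGN [x [y [g [Gx Gy Gg ind]]]]] | [x [v [e [B' [[Gx Gv He ind] _]]]]]] :=
  der1_quotient_dichotomy p_pr pG nsNG oHN ncHN.
  have [Hc Hd] : [~ x, y] \in H /\ [~ g, y] \in H by rewrite !HR.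
  have indC : indep_mod p N [~ g, y] [~ x, y].
    by move=> i j; rewrite (cHH (groupX i Hd) (groupX j Hc)) andbC; apply: ind.
  have piJ h z : h \in H -> z \in G -> coset N (h ^ z) = coset N h.
    move=> Hh Gz; have Nhz : [~ h, z] \in N.
      by apply: (subsetP sHGN); apply: mem_commg.
    rewrite conjg_mulR morphM ?NH //=; last by apply: (subsetP sNH).
    by rewrite (coset_id Nhz) mulg1.
  have xX i : coset N [~ x ^+ i, y] = coset N [~ x, y] ^+ i.
    elim: i => [|i IH]; first by rewrite comm1g morph1.
    have Hxi : [~ x ^+ i, y] \in H by rewrite HR ?groupX.
    rewrite expgS commMgJ (morphM _ (NH _ (nHG (groupX i Gx) Hc)) (NH _ Hxi)) /=.
    by rewrite IH (piJ _ _ Hc (groupX i Gx)) expgS.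
  apply: (indep_mod_commutators_bound (f := fun i => [~ g * x ^+ i, y]) Hd Hc indC) => i.
    by exists (g * x ^+ i), y; rewrite groupM ?groupX.
  have Hxi : [~ x ^+ i, y] \in H by rewrite HR ?groupX.
  rewrite commMgJ (morphM _ (NH _ (nHG (groupX i Gx) Hd)) (NH _ Hxi)) /=.
  by rewrite xX (piJ _ _ Hd (groupX i Gx)).
have [Hc Hd] : [~ x, v] \in H /\ [~ e, v] \in H by rewrite HR ?HRl.
have Ge := subsetP sHG e He.
apply: (indep_mod_commutators_bound (f := fun i => [~ x * e ^+ i, v]) Hc Hd ind) => i.
  by exists (x * e ^+ i), v; rewrite groupM ?groupX.
rewrite commMgJ (JH Hc (groupX i He)) commXg; last by apply: cHH.
by rewrite (morphM _ (NH _ Hc) (NH _ (groupX i Hd))) /= (morphX _ _ (NH _ Hd)).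
Qed.

End CyclicByPrime.

(** * The exponent of an abelian derived group *)

Section Metabelian.
Variables (gT : finGroupType) (p m : nat) (G : {group gT}).
Hypotheses (p_pr : prime p) (pG : p.-group G) (cov : comm_cover m G).
Hypothesis ncH : ~~ cyclic G^`(1).

Let H := G^`(1)%G.
Let nsHG : H <| G. Proof. exact: der_normal. Qed.
Let sHG : H \subset G. Proof. exact: normal_sub. Qed.
Let pH : p.-group H. Proof. exact: pgroupS sHG pG. Qed.

(** The reduction with W = 1 places Z inside [S / N], so the order of [H / S] divides that of the
    cyclic group controlled by [cyclic_by_prime_bound]. *)
Lemma cyclic_quotient_bound (S : {group gT}) : S <| G -> S \subset H ->
  cyclic (H / S) -> #|H / S| %| p ^ m.+1 /\ p <= m.
Proof.
move=> nsSG sSH cHS; have ncH1 : ~~ cyclic (H / 1).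
  by rewrite -(isog_cyclic (quotient1_isog H)).
have [N [nsNG _ sNS ncHN [Z [sZS sZZ oZ cHZ]]]] :=
  noncyclic_normal_quotient p_pr pG nsHG (normal1 G) nsSG (sub1G S) sSH ncH1 cHS.
have nNG := normal_norm nsNG.
have derGN : (G / N)^`(1) = H / N by rewrite -quotient_der.
have pGN : p.-group (G / N) := quotient_pgroup N pG.
have covN := comm_cover_quotient nNG cov.
have sZH : Z \subset H / N := subset_trans sZS (quotientS N sSH).
have [k oHZ] : exists k, #|H / N / Z| = (p ^ k)%N.
  have : p.-group (H / N / Z) by rewrite !quotient_pgroup.
  by case/p_natP=> k; exists k.
have [sZD cDZ ncD oDZ] : [/\ Z \subset (G / N)^`(1), cyclic ((G / N)^`(1) / Z),
    ~~ cyclic (G / N)^`(1) & #|(G / N)^`(1) / Z| = (p ^ k)%N] by rewrite derGN.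
have lek := cyclic_by_prime_bound p_pr pGN covN sZD sZZ oZ cDZ ncD oDZ.
split; last exact: prime_cover_bound p_pr pGN covN sZD sZZ oZ cDZ ncD oDZ.
apply: dvdn_trans (dvdn_exp2l p lek); rewrite -oHZ.
have sNH := subset_trans sNS sSH.
have nSH : H \subset 'N(S) := subset_trans sHG (normal_norm nsSG).
have nNS : S \subset 'N(N) := subset_trans sSH (subset_trans sHG nNG).
have snSN : S / N <| H / N by rewrite quotient_normal // /normal sSH.
rewrite -(card_isog (third_isog sNS _ _)) /normal ?sSH ?sNH ?(subset_trans sHG nNG) //.
rewrite !card_quotient ?(normal_norm snSN) //; last first.
  by rewrite cents_norm // centsC (subset_trans sZZ) // subIset // orbC centS ?quotientS.
by rewrite -(Lagrange_index (normal_sub snSN) sZS) dvdn_mulr.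
Qed.

Hypothesis abH : abelian H.

Let HX h i : h \in H -> h ^+ i \in H. Proof. exact: groupX. Qed.
Let cHH x y : x \in H -> y \in H -> commute x y.
Proof. by move=> Hx Hy; apply: (centsP abH). Qed.
Let XM x y n : x \in H -> y \in H -> (x * y) ^+ n = x ^+ n * y ^+ n.
Proof. by move=> Hx Hy; apply/expgMn/cHH. Qed.
Let MhoH k : 'Mho^k(H) = [set x ^+ (p ^ k) | x in H].
Proof. exact: MhoEabelian. Qed.
Let charM k : 'Mho^k(H) <| G.
Proof. by apply: char_normal_trans nsHG; apply: Mho_char. Qed.

(** Taking [p ^ j]-th powers identifies [H / low j] with the Frattini quotient of ['Mho^j(H)], so
    one is cyclic exactly when the other is. *)
Let low j := [set h in H | h ^+ (p ^ j) \in 'Mho^j.+1(H)].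

Let low_group j : group_set (low j).
Proof.
apply/group_setP; split=> [|x y]; first by rewrite inE !group1 expg1n group1.
by rewrite !inE => /andP[Hx Mx] /andP[Hy My]; rewrite groupM //= XM // groupM.
Qed.

Let low_normal j : group (low_group j) <| G.
Proof.
rewrite /normal; apply/andP; split.
  by apply: subset_trans sHG; apply/subsetP=> x /[!inE]/andP[].
apply/subsetP=> g Gg; rewrite inE; apply/subsetP=> _ /imsetP[x /[!inE] /andP[Hx Mx] ->].
by rewrite memJ_norm ?(subsetP (normal_norm nsHG)) // Hx -conjXg
  memJ_norm ?(subsetP (normal_norm (charM _))).
Qed.

(** Otherwise, modulo M, the derived group has exponent dividing [p ^ j.+1] and its elements killed
    by [p ^ j] come from W, hence lie in [N / M]; then [uniform_rank2_bound] with k = [j.+1]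
    contradicts the choice of j. *)
Lemma Mho_cyclic : cyclic 'Mho^(m + m)(H).
Proof.
set j := (m + m)%N; pose W := group (low_group j); pose M := 'Mho^j.+1(H)%G.
have sWH : W \subset H by apply/subsetP=> x /[!inE]/andP[].
have nHW : H \subset 'N(W) := subset_trans sHG (normal_norm (low_normal j)).
apply: contraT => ncMho.
have ncHW : ~~ cyclic (H / W).
  apply: contraNN ncMho => /cyclicP[hW eW].
  have : hW \in H / W by rewrite eW cycle_id.
  case/morphimP=> h Nh Hh def_h.
  have pQ : p.-group 'Mho^j(H) by apply: pgroupS pH; apply: Mho_sub.
  have abQ : abelian 'Mho^j(H) by apply: abelianS abH; apply: Mho_sub.
  have Qh x : x \in H -> x ^+ (p ^ j) \in 'Mho^j(H) by move=> Hx; rewrite MhoH; apply: imset_f.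
  have sMPhi : 'Mho^j.+1(H) \subset 'Phi('Mho^j(H)).
    rewrite (Phi_Mho pQ abQ) MhoH (MhoEabelian 1 pQ abQ).
    apply/subsetP=> _ /imsetP[x Hx ->]; rewrite expnSr expgM.
    by apply/imsetP; exists (x ^+ (p ^ j)); [apply: Qh | rewrite expn1].
  have nQPhi : 'Mho^j(H) \subset 'N('Phi('Mho^j(H))) by apply: normal_norm; apply: Phi_normal.
  apply: Phi_quotient_cyclic; apply: cyclicS (cycle_cyclic (coset 'Phi('Mho^j(H)) (h ^+ (p ^ j)))).
  apply/subsetP=> _ /morphimP[q Nq Qq ->];
  have /imsetP[g Hg eq] : q \in [set x ^+ (p ^ j) | x in H] by rewrite -MhoH.
  have Ng : g \in 'N(W) := subsetP nHW g Hg.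
  have : coset W g \in <[hW]> by rewrite -eW mem_quotient.
  case/cycleP=> a ea.
  have : (h ^+ a)^-1 * g \in W.
    apply: coset_idr; first by rewrite groupM ?groupV ?groupX.
    by rewrite morphM ?groupV ?groupX // morphV ?groupX // morphX //= ea def_h mulVg.
  rewrite inE => /andP[Hw Mw].
  have -> : q = (h ^+ (p ^ j)) ^+ a * ((h ^+ a)^-1 * g) ^+ (p ^ j).
    by rewrite eq -[in LHS](mulKVg (h ^+ a) g) XM ?HX // -!expgM mulnC.
  have Phiw := subsetP sMPhi _ Mw.
  have Nh' := subsetP nQPhi _ (Qh h Hh); have Nw' := subsetP nQPhi _ (Qh _ Hw).
  rewrite (morphM _ (groupX a Nh') Nw') (morphX _ _ Nh') /= (coset_id Phiw) mulg1.
  exact: mem_cycle.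
have cHH1 : cyclic (H / H) by rewrite trivg_quotient cyclic1.
have [N [nsNG sWN sNH ncHN [Z [sZH _ oZ cHZ]]]] :=
  noncyclic_normal_quotient p_pr pG nsHG (low_normal j) nsHG sWH (subxx H) ncHW cHH1.
have nHN : H \subset 'N(N) := subset_trans sHG (normal_norm nsNG).
have Np h : h \in H -> h ^+ p \in N.
  move=> Hh; apply: (subsetP sWN); rewrite inE HX //= -expgM -expnS.
  by rewrite MhoH; apply: imset_f.
have oHN : #|H / N| = (p ^ 2)%N.
  have nZ : H / N \subset 'N(Z).
    rewrite cents_norm // centsC (subset_trans sZH) //.
    exact: (quotient_abelian N abH).
  rewrite -(Lagrange sZH) oZ -card_quotient //; have [u eu] := cyclicP cHZ.
  have : u \in H / N / Z by rewrite eu cycle_id.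
  case/morphimP=> v Nv /morphimP[h Nh Hh def_v] def_u.
  have vp : v ^+ p = 1 by rewrite def_v -(morphX _ _ Nh) /= coset_id // Np.
  have up : u ^+ p = 1 by rewrite def_u -(morphX _ _ Nv) vp morph1.
  have [u1|ntu] := eqVneq u 1.
    case/negP: ncHN; apply: prime_cyclic.
    by rewrite -(Lagrange sZH) oZ -card_quotient // eu u1 cycle1 cards1 muln1.
  by rewrite eu -orderE (nt_prime_order p_pr up ntu) mulnn.
have nsMG : M <| G := charM _.
have sMN : M \subset N.
  apply: subset_trans sWN; apply/subsetP=> x Mx; rewrite inE (subsetP (Mho_sub _ _) _ Mx).
  by rewrite groupX.
have sMH := subset_trans sMN sNH.
have nMG := normal_norm nsMG.
have nHM : H \subset 'N(M) := subset_trans sHG nMG.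
have derGM : (G / M)^`(1) = H / M by rewrite -quotient_der.
have iso : H / M / (N / M) \isog H / N.
  by apply: third_isog; rewrite // /normal ?sMH ?sNH.
have NM h : h \in H -> h \in 'N(M) by move=> Hh; apply: (subsetP nHM).
suff : j.+1 <= m + m by rewrite ltnn.
apply: (@uniform_rank2_bound _ p m j.+1 (G / M)%G (N / M)%G p_pr (quotient_pgroup M pG)
  (comm_cover_quotient nMG cov)); rewrite /= ?derGM //.
- exact: quotient_abelian.
- exact: quotient_normal.
- exact: quotientS.
- by rewrite (card_isog iso).
- by rewrite (isog_cyclic iso).
- move=> _ /morphimP[h Nh Hh ->]; rewrite -(morphX _ _ Nh) /= coset_id //.
  by rewrite MhoH; apply: imset_f.
move=> _ /morphimP[h Nh Hh ->]; rewrite -(morphX _ _ Nh) /= => e.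
rewrite mem_quotient // (subsetP sWN) // inE Hh /=.
by apply: coset_idr e; rewrite groupX.
Qed.

Let ker j := [set h in H | h ^+ (p ^ j) == 1].

Let ker_group j : group_set (ker j).
Proof.
apply/group_setP; split=> [|x y]; first by rewrite inE group1 expg1n eqxx.
by rewrite !inE => /andP[Hx /eqP x1] /andP[Hy /eqP y1]; rewrite groupM //= XM // x1 y1 mulg1.
Qed.

Let ker_normal j : group (ker_group j) <| G.
Proof.
rewrite /normal; apply/andP; split.
  by apply: subset_trans sHG; apply/subsetP=> x /[!inE]/andP[].
apply/subsetP=> g Gg; rewrite inE; apply/subsetP=> _ /imsetP[x /[!inE] /andP[Hx /eqP x1] ->].
by rewrite memJ_norm ?(subsetP (normal_norm nsHG)) // Hx -conjXg x1 conj1g /=.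
Qed.

(** [H / S] is isomorphic to the cyclic group ['Mho^j(H)], so its order divides [p ^ m.+1]; S itself
    is killed by [p ^ (m + m)]. *)
Lemma metabelian_exponent :
  p <= m /\ forall h, h \in H -> h ^+ (p ^ (m.+1 + (m + m))) = 1.
Proof.
set j := (m + m)%N; pose S := group (ker_group j).
have sSH : S \subset H by apply/subsetP=> x /[!inE]/andP[].
have nHS : H \subset 'N(S) := subset_trans sHG (normal_norm (ker_normal j)).
have cHS : cyclic (H / S).
  have /cyclicP[q eq] := Mho_cyclic.
  have : q \in 'Mho^(m + m)(H) by rewrite eq cycle_id.
  rewrite MhoH => /imsetP[h Hh def_q].
  apply: cyclicS (cycle_cyclic (coset S h)); apply/subsetP=> _ /morphimP[g Ng Hg ->].
  have Nh : h \in 'N(S) := subsetP nHS h Hh.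
  have : g ^+ (p ^ j) \in <[q]> by rewrite -eq MhoH; apply: imset_f.
  case/cycleP=> a ea; have Sw : (h ^+ a)^-1 * g \in S.
    rewrite inE groupM ?groupV ?HX //= XM ?groupV ?HX // ea def_q -/j.
    by rewrite expgVn -!expgM mulnC mulVg.
  rewrite -(mulKVg (h ^+ a) g) morphM ?groupX //=; last by rewrite groupM ?groupV ?groupX.
  by rewrite (coset_id Sw) mulg1 (morphX _ _ Nh) mem_cycle.
have [dv lepm] := cyclic_quotient_bound (ker_normal j) sSH cHS.
split=> // h Hh; have Nh : h \in 'N(S) := subsetP nHS h Hh.
suff : h ^+ (p ^ m.+1) \in S by rewrite inE => /andP[_ /eqP]; rewrite -expgM -expnD.
apply: coset_idr; first exact: groupX.
rewrite (morphX _ _ Nh) /=; case/dvdnP: dv => r ->; rewrite mulnC expgM.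
by rewrite (expg_cardG (mem_quotient S Hh)) expg1n.
Qed.

End Metabelian.

(** * Order and exponent of derived groups *)

Section SchurExponent.
Import GRing.Theory FiniteModule.

(* The transfer into a central subgroup of index n is x |-> x^n. *)
Lemma der1_expg_index_center (gT : finGroupType) (G Z : {group gT}) x :
  Z \subset 'Z(G) -> x \in G^`(1) -> x ^+ #|G : Z| = 1.
Proof.
move=> sZZ Hx; have sZG : Z \subset G := subset_trans sZZ (center_sub G).
have cZ : abelian Z.
  by apply: subset_trans sZZ (subset_trans (subsetIr _ _) (centS sZG)).
have cZ' : abelian (idm Z @* Z) by rewrite morphim_idm.
have vE : {in G, forall g, fmval (transfer G cZ' g) = g ^+ #|G : Z|}.
  move=> g Gg; have trX := transversalP (rcosets_cycle_partition sZG Gg).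
  rewrite (transfer_cycle_expansion sZG cZ' Gg trX).
  rewrite -(sum_index_rcosets_cycle sZG Gg trX).
  elim/big_rec2: _ => [|r n u Xr IH]; first by rewrite fmval0 expg0.
  have Gr : r \in G by apply: (subsetP (transversal_sub trX)).
  have Zgn : (g ^+ #|<[g]> : Z :* r|) ^ r^-1 \in Z.
    have := mulg_exp_card_rcosets Z g r; rewrite mem_rcoset /conjg invgK.
    by rewrite mulgA.
  have cgn : (g ^+ #|<[g]> : Z :* r|) ^ r^-1 = g ^+ #|<[g]> : Z :* r|.
    have /setIP[_ /centP cG] := subsetP sZZ _ Zgn.
    by rewrite -[RHS](conjgKV r) [RHS]conjgE (cG r Gr) mulKg.
  rewrite fmvalA expgD; congr (_ * _); last exact: IH.
  rewrite cgn in Zgn *; apply: fmodK.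
  exact: (mem_morphim (idm_morphism Z)).
suff : transfer G cZ' x = 0%R.
  by move/(congr1 (@fmval _ _ _)); rewrite vE ?(subsetP (der_sub 1 G)) // fmval0.
pose V := transfer_morphism G cZ'.
suff /subsetP/(_ x Hx) : G^`(1) \subset 'ker V by move/mker.
rewrite gen_subG; apply/subsetP=> _ /imset2P[y z Gy Gz ->].
apply/kerP; first by rewrite groupR.
rewrite morphR //=; apply/eqP/commgP; exact: addrC.
Qed.

End SchurExponent.

(** * Dietzmann's lemma with an explicit bound *)

Section Dietzmann.
Variables (gT : finGroupType) (K : {set gT}) (e : nat).
Hypotheses (e_gt0 : 0 < e) (expK : forall k, k \in K -> k ^+ e = 1).
Hypothesis conjK : forall k l, k \in K -> l \in K -> k ^ l \in K.
Hypothesis K1 : 1 \in K.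

Let prod (w : seq gT) := \prod_(x <- w) x.

Let conjKX k l i : k \in K -> l \in K -> k ^ (l ^+ i) \in K.
Proof.
move=> Kk Kl; elim: i => [|i IH]; first by rewrite conjg1.
by rewrite expgSr conjgM conjK.
Qed.

(** Moving copies of k to the left across a letter conjugates that letter, which stays in K, and
    preserves the length. *)
Lemma word_collect w k j : k \in K -> {subset w <= K} -> j <= count_mem k w ->
  exists w', [/\ {subset w' <= K}, size w' + j = size w & prod w = k ^+ j * prod w'].
Proof.
move=> Kk; elim: w j => [|a w IH] [|j] sK //= le.
- by exists [::]; split; rewrite // expg0 mul1g.
- by exists (a :: w); split; rewrite // ?addn0 // expg0 mul1g.
have sKw : {subset w <= K} by move=> x xw; apply: sK; rewrite inE xw orbT.
have Ka : a \in K by apply: sK; rewrite inE eqxx.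
have [eak | neak] := eqVneq a k.
  move: le; rewrite eak eqxx add1n ltnS => /(IH _ sKw)[w' [sw' szw' ew']].
  exists w'; split; rewrite // ?addnS ?szw' //.
  by rewrite /prod big_cons -/(prod w) ew' expgS mulgA.
move: le; rewrite (negbTE neak) add0n => /(IH _ sKw)[w' [sw' szw' ew']].
exists (a ^ (k ^+ j.+1) :: w'); split.
- by move=> x; rewrite inE => /orP[/eqP->|/sw' //]; apply: conjKX.
- by rewrite /= addSn szw'.
by rewrite /prod !big_cons -/(prod w) -/(prod w') ew' mulgA (conjgC a) -mulgA.
Qed.

(** In a word longer than [#|K| * e] some letter occurs e times; its collected copies multiply to 1
    and are dropped. *)
Lemma word_shorten w : {subset w <= K} ->
  exists w', [/\ {subset w' <= K}, size w' <= #|K| * e & prod w' = prod w].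
Proof.
move: {2}(size w) (leqnn (size w)) => n; elim: n w => [|n IH] w szw sK.
  by exists w; split; rewrite // (leq_trans szw).
have [le | gt] := leqP (size w) (#|K| * e); first by exists w.
have [k Kk lek] : exists2 k, k \in K & e <= count_mem k w.
  apply/exists_inP; apply: contraLR gt; rewrite negb_exists_in -leqNgt => /forall_inP h.
  have -> : size w = \sum_(k in K) count_mem k w.
    have -> : size w = count (mem K) w by apply/esym/eqP; rewrite -all_count; apply/allP.
    rewrite -sum1_count (partition_big id (mem K)) //=.
    apply: eq_bigr => k Kk; rewrite sum1_count; apply: eq_count => x /=.
    by case: eqP => [->|]; rewrite ?Kk ?andbF.
  rewrite -sum_nat_const leq_sum // => k Kk.
  by apply: ltnW; rewrite ltnNge h.
have [w' [sw' szw' ew']] := word_collect Kk sK lek.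
have [||w2 [sw2 szw2 ew2]] := IH w' => //.
  by rewrite -ltnS (leq_trans _ szw) // -szw' -[X in X < _]addn0 ltn_add2l.
by exists w2; split; rewrite // ew2 ew' expK // mul1g.
Qed.

Lemma card_gen_bound : #|<<K>>| <= #|K| ^ (#|K| * e).
Proof.
set L := (#|K| * e)%N.
pose F (f : {ffun 'I_L -> gT}) := \prod_i f i.
have sub : <<K>> \subset F @: [set f | f \in ffun_on (mem K)].
  apply/subsetP=> h /gen_prodgP[n [c cK ->]].
  have [|w [sw szw ew]] := @word_shorten [seq c i | i <- index_enum (ordinal n)].
    by move=> _ /mapP[i _ ->].
  (* Short words are padded with 1, an element of K. *)
  apply/imsetP; exists [ffun i : 'I_L => nth 1 w i].
    rewrite inE; apply/ffun_onP=> i; rewrite ffunE.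
    have [lt|ge] := ltnP i (size w); first by rewrite sw ?mem_nth.
    by rewrite nth_default.
  rewrite /F; under [RHS]eq_bigr do rewrite ffunE.
  rewrite -(big_mkord xpredT (fun i => nth 1 w i)) (big_cat_nat (n := size w)) //=.
  rewrite [X in _ * X]big_nat_cond [X in _ * X]big1 ?mulg1; last first.
    by move=> i /andP[/andP[le _] _]; rewrite nth_default.
  by rewrite -(big_nth 1 xpredT id) -/(prod w) ew /prod big_map.
apply: leq_trans (subset_leq_card sub) _; apply: leq_trans (leq_imset_card _ _) _.
by rewrite cardsE card_ffun_on card_ord.
Qed.

End Dietzmann.

(** A cyclic group has at most e elements killed by e, so there are at most [m * e] commutators, and
    they form a set closed under conjugation. *)
Lemma card_der1_bound m e (gT : finGroupType) (G : {group gT}) :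
    0 < e -> comm_cover m G -> (forall h, h \in G^`(1) -> h ^+ e = 1) ->
  #|G^`(1)| <= (m * e) ^ (m * e * e).
Proof.
move=> e_gt0 [s sP] expH; pose K := commg_set G G.
have HK k : k \in K -> k \in G^`(1) by apply: mem_gen.
have K1 : 1 \in K by apply/imset2P; exists 1 1; rewrite ?group1 ?comm1g.
have leK : #|K| <= m * e.
  have sub : K \subset \bigcup_(i < m) 'Ldiv_e(<[s i]>).
    apply/subsetP=> k Kk; have /imset2P[x y Gx Gy ek] := Kk.
    have [i si] := sP x y Gx Gy; apply/bigcupP; exists i => //.
    by rewrite !inE ek si -ek expH ?HK //=.
  apply: leq_trans (subset_leq_card sub) _.
  apply: leq_trans (_ : \sum_(i < m) #|'Ldiv_e(<[s i]>)| <= _).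
    elim/big_rec2: _ => [|i a A _ le]; first by rewrite cards0.
    by apply: leq_trans (leq_card_setU _ _) _; rewrite leq_add2l.
  apply: leq_trans (_ : \sum_(i < m) e <= _); last by rewrite sum_nat_const card_ord.
  apply: leq_sum => i _.
  pose A := group (group_Ldiv e (cycle_abelian (s i))).
  have cA : cyclic A by apply: cyclicS (cycle_cyclic (s i)); apply: subsetIl.
  rewrite -[#|_|]/#|A| -(exponent_cyclic cA) dvdn_leq //.
  by apply/exponentP=> x; rewrite !inE => /andP[_ /eqP].
have K0 : 0 < #|K| by apply/card_gt0P; exists 1.
rewrite [G^`(1)]derg1 -/K; apply: leq_trans (card_gen_bound e_gt0 _ _ K1) _.
- by move=> k /HK/expH.
- move=> k l /imset2P[x y Gx Gy ->] /HK Hl.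
  have Gl : l \in G by apply: (subsetP (der_sub 1 G)).
  by rewrite conjRg; apply/imset2P; exists (x ^ l) (y ^ l); rewrite ?groupJ.
apply: leq_trans (_ : (m * e) ^ (#|K| * e) <= _); first by rewrite leq_exp2r ?muln_gt0 ?K0.
by rewrite leq_pexp2l ?leq_mul2r ?leK ?orbT // (leq_trans K0).
Qed.

(** * Commutators acting on an abelian normal subgroup *)

Section AbelianNormal.
Variables (gT : finGroupType) (m : nat) (G A : {group gT}).
Hypotheses (cov : comm_cover m G) (nsAG : A <| G) (abA : abelian A).

Let nAG g a : g \in G -> a \in A -> a ^ g \in A.
Proof. by move=> Gg Aa; rewrite memJ_norm // (subsetP (normal_norm nsAG)). Qed.
Let sAG : A \subset G. Proof. exact: normal_sub. Qed.
Let cAA x y : x \in A -> y \in A -> commute x y.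
Proof. by move=> Ax Ay; apply: (centsP abA). Qed.
Let JA x y : x \in A -> y \in A -> x ^ y = x.
Proof. by move=> Ax Ay; rewrite conjgE (cAA Ax Ay) mulKg. Qed.
Let XM x y n : x \in A -> y \in A -> (x * y) ^+ n = x ^+ n * y ^+ n.
Proof. by move=> Ax Ay; apply/expgMn/cAA. Qed.
Let mulACA a b c d : b \in A -> c \in A -> a * b * (c * d) = a * c * (b * d).
Proof. by move=> Ab Ac; rewrite !mulgA -(mulgA a) (cAA Ab Ac) mulgA. Qed.
Let comMl c a b : c \in G -> a \in A -> b \in A -> [~ a * b, c] = [~ a, c] * [~ b, c].
Proof.
move=> Gc Aa Ab; rewrite commMgJ JA // groupM ?groupV ?nAG //.
Qed.
Let comA c a : c \in G -> a \in A -> [~ a, c] \in A.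
Proof. by move=> Gc Aa; rewrite groupM ?groupV ?nAG. Qed.
Let comX c a n : c \in G -> a \in A -> [~ a ^+ n, c] = [~ a, c] ^+ n.
Proof. by move=> Gc Aa; rewrite commXg //; apply: cAA; rewrite ?comA. Qed.

(* [c theta(a)] and [c theta(b)] in one cyclic subgroup force
   [theta(a), c] = [theta(b), c], so the group of all [theta(a), c] has order
   at most m. *)
Lemma comm_coset_expg c (theta : gT -> gT) : c \in G ->
    (forall a, a \in A -> theta a \in A) ->
    {in A &, {morph theta : a b / a * b}} ->
    (forall a, a \in A -> exists x y, [/\ x \in G, y \in G & c * theta a = [~ x, y]]) ->
  forall a, a \in A -> [~ theta a, c] ^+ m`! = 1.
Proof.
move=> Gc tA tM tcomm a Aa; have [s sP] := cov.
pose I := [set [~ theta b, c] | b in A].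
have I_group : group_set I.
  apply/group_setP; split=> [|_ _ /imsetP[b1 Ab1 ->] /imsetP[b2 Ab2 ->]].
    apply/imsetP; exists 1 => //; apply: (mulgI [~ theta 1, c]).
    by rewrite mulg1 -comMl ?tA // -tM // mulg1.
  by apply/imsetP; exists (b1 * b2); rewrite ?groupM // tM // comMl ?tA.
(* One representative b for each cyclic subgroup; where none exists, 1 is a dummy value. *)
pose r (i : 'I_m) := odflt 1 [pick b in A | c * theta b \in <[s i]>].
have leI : #|I| <= m.
  have sub : I \subset [set [~ theta (r i), c] | i : 'I_m].
    apply/subsetP=> _ /imsetP[b Ab ->].
    have [x [y [Gx Gy e]]] := tcomm b Ab; have [i si] := sP x y Gx Gy.
    apply/imsetP; exists i => //; rewrite /r; case: pickP => [b' /andP[Ab' sb'] | /(_ b)] /=; last first.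
      by rewrite Ab e si.
    have com : commute (c * theta b) (c * theta b').
      by apply: (centsP (cycle_abelian (s i))); rewrite ?e.
    have Ad : (theta b)^-1 * theta b' \in A by rewrite groupM ?groupV ?tA.
    have cd : commute ((theta b)^-1 * theta b') c.
      have e1 : (theta b)^-1 * theta b' = (c * theta b)^-1 * (c * theta b').
        by rewrite invMg -mulgA mulKg.
      have cc1 : commute ((theta b)^-1 * theta b') (c * theta b).
        rewrite e1; apply: commute_sym; apply: commuteM => //.
        by apply: commuteV.
      have -> : c = c * theta b * (theta b)^-1 by rewrite mulgK.
      apply: commuteM => //; apply: commuteV; apply: cAA => //; exact: tA.
    rewrite -(mulKVg (theta b) (theta b')) comMl ?tA //.
    by rewrite ((_ =P 1) (introT commgP cd)) mulg1.
  apply: leq_trans (subset_leq_card sub) _.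
  by apply: leq_trans (leq_imset_card _ _) _; rewrite card_ord.
have Ia : [~ theta a, c] \in group I_group by apply: imset_f.
have /dvdnP[q ->] : #|group I_group| %| m`! by apply: dvdn_fact; rewrite cardG_gt0.
by rewrite mulnC expgM expg_cardG // expg1n.
Qed.

(** Both [[~ x * b, y]] and [[~ x, y * b]] have the form c theta(b), which yields
    [P (b ^ y) = P b ^ c] and [P (b ^ x) ^ c = P b]. Seen through P, y acts as c and x as its
    inverse; these commute, so their commutator c acts trivially, although [P (a ^ c) = P a ^ c]. *)
Lemma comm_fixed x y a : x \in G -> y \in G -> a \in A ->
  ([~ a, [~ x, y]] ^+ m`!) ^ [~ x, y] = [~ a, [~ x, y]] ^+ m`!.
Proof.
move=> Gx Gy Aa; have [c dc] : exists c, c = [~ x, y] by exists [~ x, y].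
rewrite -dc; have Gc : c \in G by rewrite dc groupR.
pose P b := [~ b, c] ^+ m`!.
have PM b1 b2 : b1 \in A -> b2 \in A -> P (b1 * b2) = P b1 * P b2.
  by move=> A1 A2; rewrite /P comMl // XM ?comA.
have PV b : b \in A -> P b^-1 = (P b)^-1.
  move=> Ab; apply/eqP; rewrite eq_sym eq_invg_mul -PM ?groupV // mulgV.
  by rewrite /P comm1g expg1n.
have Pc b : P (b ^ c) = P b ^ c by rewrite /P conjXg conjRg (conjgE c c) mulKg.
have Py b : b \in A -> P (b ^ y) = P b ^ c.
  move=> Ab; have : P ((b ^ c)^-1 * b ^ y) = 1.
    apply: (@comm_coset_expg c (fun b => (b ^ c)^-1 * b ^ y)) => //.
    - by move=> b1 A1; rewrite groupM ?groupV ?nAG.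
    - move=> b1 b2 A1 A2; rewrite !conjMg invMg [(_ ^ c)^-1 * _]cAA ?groupV ?nAG //.
      by rewrite mulACA ?groupV ?nAG.
    move=> b1 A1; have Gb := subsetP sAG b1 A1.
    exists (x * b1), y; rewrite groupM //; split=> //.
    rewrite commMgJ -dc (conjg_mulR c b1) -[RHS]mulgA; congr (_ * _).
    by rewrite commgEr commgEl [RHS]mulgA mulgK conjVg.
  rewrite PM ?groupV ?nAG // PV ?nAG // Pc => e.
  by apply: (mulgI (P b ^ c)^-1); rewrite e mulVg.
have Px b : b \in A -> P (b ^ x) ^ c = P b.
  move=> Ab; have : P ((b ^ (x * c))^-1 * b) = 1.
    apply: (@comm_coset_expg c (fun b => (b ^ (x * c))^-1 * b)) => //.
    - by move=> b1 A1; rewrite groupM ?groupV ?nAG ?groupM.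
    - move=> b1 b2 A1 A2; have Gxc : x * c \in G by rewrite groupM.
      rewrite !conjMg invMg [(_ ^ (x * c))^-1 * _]cAA ?groupV ?nAG //.
      by rewrite mulACA ?groupV ?nAG.
    move=> b1 A1; have Gb := subsetP sAG b1 A1.
    exists x, (y * b1); rewrite groupM //; split=> //.
    rewrite commgMJ -dc (conjg_mulR c b1) [RHS]mulgA (conjgC [~ x, b1] c) -[RHS]mulgA.
    by congr (_ * _); rewrite !commgEr conjMg -conjgM !conjVg -mulgA mulKVg.
  have Gxc : x * c \in G by rewrite groupM.
  rewrite PM ?groupV ?nAG // PV ?nAG // conjgM Pc => e.
  by apply: (mulgI (P (b ^ x) ^ c)^-1); rewrite e mulVg.
have AV b z : b \in A -> z \in G -> b ^ z^-1 \in A.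
  by move=> Ab Gz; rewrite nAG ?groupV.
set w := (a ^ x^-1) ^ y^-1.
have Aw : w \in A by rewrite !AV.
have e1 : P (a ^ c) = P w.
  have -> : a ^ c = (w ^ x) ^ y.
    by rewrite dc /w -!conjgM; congr (a ^ _); rewrite commgEl conjgE !mulgA.
  by rewrite (Py _ (nAG Gx Aw)) Px.
have e2 : P a = P w.
  have ew : w ^ y = a ^ x^-1 by rewrite /w conjgKV.
  have := Px _ (AV a x Aa Gx); rewrite conjgKV -ew Py // => e.
  by rewrite -[LHS](conjgK c) e conjgK.
by rewrite -/(P a) -Pc e1 e2.
Qed.

(** Since c fixes [[~ a, c] ^+ M], conjugation by [c ^+ i] multiplies [a ^+ M] by the i-th power of
    that element; for i = n it changes nothing. *)
Lemma comm_expg_bound x y a n : x \in G -> y \in G -> a \in A ->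
  [~ x, y] ^+ n \in 'C(A) -> [~ a, [~ x, y]] ^+ (m`! * n) = 1.
Proof.
move=> Gx Gy Aa; have := comm_fixed Gx Gy Aa.
have Gc : [~ x, y] \in G by rewrite groupR.
move: [~ x, y] Gc => c Gc fix_b cn; set M := m`! in fix_b *.
have Ab : [~ a, c] ^+ M \in A by rewrite groupX ?comA.
have aE i : (a ^+ M) ^ (c ^+ i) = a ^+ M * ([~ a, c] ^+ M) ^+ i.
  elim: i => [|i IH]; first by rewrite expg0 conjg1 mulg1.
  rewrite expgSr conjgM IH conjMg [(_ ^+ i) ^ c]conjXg fix_b conjg_mulR comX // -mulgA.
  by rewrite -expgS.
have := aE n; rewrite (_ : a ^+ M ^ c ^+ n = a ^+ M).
  by rewrite -{1}[a ^+ M]mulg1 => /mulgI; rewrite -expgM => <-.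
by apply/conjg_fixP/commgP; apply: commute_sym; apply: (centP cn); rewrite groupX.
Qed.

End AbelianNormal.

(** W contains every [[~ a, [~ x, y]]], so [A / W] is central of index n in [H / W]. In the
    exponent, e leads from H into its derived group, n from there into W by Schur's theorem, and the
    last factor kills W. *)
Lemma exponent_step m e (gT : finGroupType) (G A : {group gT}) :
    comm_cover m G -> A <| G -> abelian A -> A \subset G^`(1) ->
    (forall h, h \in G^`(1) -> h ^+ e \in G^`(2)) ->
  forall h, h \in G^`(1) ->
    h ^+ (e * #|G^`(1) : A| * (m`! * #|G^`(1) : A|)) = 1.
Proof.
move=> cov nsAG abA sAH expH; set H := G^`(1); set n := #|H : A|.
have sHG : H \subset G := der_sub 1 G.
have nAH : H \subset 'N(A) := subset_trans sHG (normal_norm nsAG).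
have Xn h : h \in H -> h ^+ n \in A.
  move=> Hh; have Nh := subsetP nAH h Hh; apply: coset_idr; first exact: groupX.
  rewrite (morphX _ _ Nh) /= /n -card_quotient //.
  by rewrite (expg_cardG (mem_quotient A Hh)).
have [W WE] : exists W : {group gT},
    forall a, (a \in W) = (a \in A) && (a ^+ (m`! * n) == 1).
  by exists (group (group_Ldiv (m`! * n) abA)) => a; rewrite !inE.
have sWA : W \subset A by apply/subsetP=> a; rewrite WE => /andP[].
have nsWG : W <| G.
  rewrite /normal (subset_trans sWA (normal_sub nsAG)) /=.
  apply/subsetP=> g Gg; rewrite inE; apply/subsetP=> _ /imsetP[a Wa ->].
  move: Wa; rewrite !WE => /andP[Aa /eqP a1].
  by rewrite memJ_norm ?(subsetP (normal_norm nsAG)) // Aa -conjXg a1 conj1g /=.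
have nWG := normal_norm nsWG; have nWH := subset_trans sHG nWG.
have nWA := subset_trans sAH nWH.
have sHD : H \subset coset W @*^-1 'C(A / W).
  rewrite gen_subG; apply/subsetP=> _ /imset2P[x y Gx Gy ->].
  have Hc : [~ x, y] \in H by apply: mem_commg.
  have Nc := subsetP nWH _ Hc.
  apply/morphpreP; split=> //; apply/centP=> _ /morphimP[a Na Aa ->].
  apply: commute_sym; apply/commgP/eqP; rewrite -morphR //= coset_id // WE.
  have nAc : [~ x, y] \in 'N(A) := subsetP nAH _ Hc.
  rewrite groupM ?groupV ?memJ_norm //=; apply/eqP; apply: (comm_expg_bound cov nsAG abA Gx Gy Aa).
  by apply: (subsetP abA); apply: Xn.
have cAW : A / W \subset 'Z(H / W).
  rewrite subsetI quotientS //= centsC; have := quotientS W sHD.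
  by rewrite cosetpreK.
have idx : #|H / W : A / W| = n.
  by rewrite index_quotient_eq // subIset // sWA orbT.
move=> h Hh; have H2 := expH h Hh.
have Nh2 : h ^+ e \in 'N(W) by rewrite groupX // (subsetP nWH).
have W2 : (h ^+ e) ^+ n \in W.
  apply: coset_idr; first exact: groupX.
  have := @der1_expg_index_center _ (G^`(1) / W)%G (A / W)%G (coset W (h ^+ e)) cAW.
  rewrite /= idx => e1; rewrite (morphX _ _ Nh2) /=; apply: e1.
  by rewrite -quotient_der // mem_quotient.
by move: W2; rewrite WE -!expgM => /andP[_ /eqP].
Qed.

(** * The common normaliser of the cyclic groups generated by commutators *)

Section Normalizer.
Variables (gT : finGroupType) (p m : nat) (G : {group gT}).
Hypotheses (p_pr : prime p) (pG : p.-group G) (cov : comm_cover m G).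

Let K := commg_set G G.
Let KG k : k \in K -> k \in G.
Proof. by case/imset2P=> x y Gx Gy ->; apply: groupR. Qed.
Let KJ k g : k \in K -> g \in G -> k ^ g \in K.
Proof.
case/imset2P=> x y Gx Gy -> Gg; rewrite conjRg.
by apply/imset2P; exists (x ^ g) (y ^ g); rewrite ?groupJ.
Qed.

Definition cycles_normalizer := (\bigcap_(k in K) 'N_G(<[k]>))%G.

Lemma index_setI_le (A B : {group gT}) : A \subset G -> B \subset G ->
  #|G : A :&: B| <= #|G : A| * #|G : B|.
Proof.
move=> sAG sBG; have sAB : A :&: B \subset G by rewrite subIset // sAG.
have le : #|A| * #|B| <= #|G| * #|A :&: B|.
  by rewrite mul_cardG leq_mul2r subset_leq_card ?orbT // mul_subG.
have [eA [eB eAB]] := (Lagrange sAG, (Lagrange sBG, Lagrange sAB)).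
have G0 : 0 < #|G| * #|A :&: B| by rewrite muln_gt0 !cardG_gt0.
rewrite -(leq_pmul2r G0).
have -> : (#|G : A :&: B| * (#|G| * #|A :&: B|) = #|G : A| * #|G : B| * (#|A| * #|B|))%N.
  by rewrite mulnCA [(_ * #|A :&: B|)%N]mulnC eAB mulnACA ![(#|G : _| * _)%N]mulnC eA eB.
by rewrite leq_mul2l le orbT.
Qed.

Lemma index_common_subgroup (I : eqType) (F : I -> {group gT}) :
    (forall i, F i \subset G) -> (forall i, #|G : F i| <= m) ->
  forall r : seq I, exists B : {group gT},
    [/\ B \subset G, forall i, i \in r -> B \subset F i & #|G : B| <= m ^ size r].
Proof.
move=> sFG leF; elim=> [|i r [B [sBG sBF leB]]]; first by exists G; rewrite indexgg.
exists (F i :&: B)%G; split=> [|j|]; first by rewrite subIset // sFG.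
  by rewrite inE => /orP[/eqP->|/sBF sBj]; rewrite ?subsetIl // subIset // sBj orbT.
by apply: leq_trans (index_setI_le (sFG i) sBG) _; rewrite expnS leq_mul.
Qed.

(** Each conjugate of [<[k]>] is generated by a commutator, so it lies in a member of the cover,
    where it is the only subgroup of its order. *)
Lemma index_normalizer_cycle k : k \in K -> #|G : 'N_G(<[k]>)| <= m.
Proof.
move=> Kk; rewrite -card_conjugates; have [s sP] := cov.
have sub : <[k]> :^: G \subset [set <[s i ^+ (#[s i] %/ #[k])]> | i : 'I_m].
  apply/subsetP=> _ /imsetP[g Gg ->]; have Kkg := KJ Kk Gg.
  have /imset2P[x y Gx Gy e] := Kkg; have [i si] := sP x y Gx Gy.
  apply/imsetP; exists i => //; rewrite -cycleJ.
  rewrite -e in si; have skg : <[k ^ g]> \subset <[s i]> by rewrite cycle_subG.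
  apply/eqP; rewrite (eq_subG_cyclic (cycle_cyclic (s i))) ?cycleX //.
  have dv : #[k] %| #[s i] by rewrite -(orderJ k g) orderE cardSg.
  case/dvdnP: dv => q eq; rewrite -!orderE orderJ eq mulnK ?order_gt0 //.
  have q0 : 0 < q by have := order_gt0 (s i); rewrite eq muln_gt0 => /andP[].
  by rewrite orderXdiv eq ?dvdn_mulr // mulKn.
apply: leq_trans (subset_leq_card sub) _.
by apply: leq_trans (leq_imset_card _ _) _; rewrite card_ord.
Qed.

(** The commutators in [<[s i]>] generate a chain of subgroups with a largest member [<[c i]>].
    Whatever normalises it normalises all its subgroups, so m normalisers of index at most m
    suffice. *)
Lemma index_cycles_normalizer : #|G : cycles_normalizer| <= m ^ m.
Proof.
have [s sP] := cov.
have cP i : exists c, [/\ c \in K, c \in <[s i]> & forall k, k \in K -> k \in <[s i]> -> k \in <[c]>].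
  have K1 : (1 \in K) && (1 \in <[s i]>).
    by rewrite group1 andbT; apply/imset2P; exists 1 1; rewrite ?group1 ?comm1g.
  case: (arg_maxnP (P := fun c => (c \in K) && (c \in <[s i]>)) (fun c : gT => #[c]) K1).
  move=> c /andP[Kc sc] maxc; exists c; split=> // k Kk sk.
  have [//|ck] := p_elt_cyclic_chain p_pr (cycle_cyclic (s i)) sk sc
    (mem_p_elt pG (KG Kk)) (mem_p_elt pG (KG Kc)).
  have := maxc k; rewrite Kk sk => /(_ isT) le.
  have /eqP -> : <[c]> == <[k]> by rewrite eqEcard cycle_subG ck -!orderE.
  exact: cycle_id.
have [c {}cP] := fin_all_exists cP.
have [D [sDG sDN leD]] := index_common_subgroup (fun i => subsetIl G 'N(<[c i]>))
  (fun i => index_normalizer_cycle (let: And3 Kc _ _ := cP i in Kc)) (enum 'I_m).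
have sDC : D \subset cycles_normalizer.
  apply/bigcapsP=> k Kk; have /imset2P[x y Gx Gy e] := Kk; have [i si] := sP x y Gx Gy.
  rewrite -e in si; have [_ _ /(_ k Kk si) kc] := cP i.
  rewrite subsetI sDG; apply: subset_trans (sDN i (mem_enum _ _)) _.
  apply: subset_trans (subsetIr _ _) _.
  by apply: char_norms; apply: cycle_subgroup_char; rewrite cycle_subG.
by rewrite size_enum_ord in leD; apply: leq_trans leD; rewrite dvdn_leq ?indexgS ?indexg_gt0.
Qed.

Lemma cycles_normalizer_normal : cycles_normalizer <| G.
Proof.
have CE z : (z \in cycles_normalizer) = (z \in G) && [forall k in K, z \in 'N(<[k]>)].
  apply/bigcapP/andP=> [h | [Gz /forall_inP h] k Kk]; last by rewrite inE Gz h.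
  have K1 : 1 \in K by apply/imset2P; exists 1 1; rewrite ?group1 ?comm1g.
  split; first by case/setIP: (h 1 K1).
  by apply/forall_inP=> k Kk; case/setIP: (h k Kk).
apply/normalP; split=> [|g Gg]; first by apply/subsetP=> z; rewrite CE => /andP[].
suff sub h : h \in G -> cycles_normalizer :^ h \subset cycles_normalizer.
  apply/eqP; rewrite eqEsubset sub //= -sub_conjgV sub // groupV //.
move=> Gh; apply/subsetP=> _ /imsetP[z + ->]; rewrite !CE => /andP[Gz /forall_inP nz].
rewrite groupJ //; apply/forall_inP=> k Kk; have := nz _ (KJ Kk (groupVr Gh)).
by rewrite cycleJ normJ mem_conjgV.
Qed.

(** Automorphisms of a cyclic group are power maps and commute. *)
Lemma comm_cent_cycle (c g h : gT) :
  g \in 'N(<[c]>) -> h \in 'N(<[c]>) -> c ^ [~ g, h] = c.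
Proof.
move=> ng nh; have cX z : z \in 'N(<[c]>) -> exists i, c ^ z = c ^+ i.
  by move=> nz; apply/cycleP; rewrite memJ_norm ?cycle_id.
have [i ei] := cX g ng; have [j ej] := cX h nh.
have [l el] := cX (h * g)^-1 (groupVr (groupM nh ng)).
have e1 : c ^ (g * h) = c ^ (h * g).
  by rewrite !conjgM ei ej !conjXg ei ej -!expgM mulnC.
have e2 : [~ g, h] = (h * g)^-1 * (g * h).
  by rewrite commgEl conjgE invMg !mulgA.
by rewrite e2 conjgM el conjXg e1 -conjXg -el conjgKV.
Qed.

Lemma cycles_normalizer_der1_cent : cycles_normalizer^`(1) \subset 'C(G^`(1)).
Proof.
rewrite gen_subG; apply/subsetP=> _ /imset2P[g h Gg Gh ->].
rewrite -sub_cent1 gen_subG; apply/subsetP=> c Kc.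
have nc z : z \in cycles_normalizer -> z \in 'N(<[c]>).
  by move/bigcapP/(_ c Kc)/setIP=> [].
apply/cent1P/commgP/conjg_fixP.
exact: comm_cent_cycle (nc g Gg) (nc h Gh).
Qed.

End Normalizer.

(** * The uniform bound for finite p-groups *)

Definition card_bound (m e : nat) := ((m * e) ^ (m * e * e))%N.

Lemma card_bound_mono m e e' :
  0 < m -> 0 < e -> e <= e' -> card_bound m e <= card_bound m e'.
Proof.
move=> m0 e0 le; have e0' := leq_trans e0 le; rewrite /card_bound.
apply: leq_trans (_ : (m * e') ^ (m * e * e) <= _).
  by rewrite leq_exp2r ?muln_gt0 ?m0 ?e0 // leq_mul2l le orbT.
by rewrite leq_pexp2l ?muln_gt0 ?m0 // !leq_mul.
Qed.

(* [e0] bounds the exponent of [H / H'] and [e1] that of [H / (H :&: G0)'],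
   where [G0] is [cycles_normalizer G]. *)
Definition derived_bound m :=
  let e0 := (m ^ (m.+1 + (m + m)))%N in
  let e1 := (e0 * m ^ m * (m`! * m ^ m))%N in
  card_bound m (e0 * card_bound m e1).

Lemma derived_cyclic_or_bounded p m (gT : finGroupType) (G : {group gT}) :
    0 < m -> prime p -> p.-group G -> comm_cover m G ->
  cyclic G^`(1) \/ #|G^`(1)| <= derived_bound m.
Proof.
move=> m0 p_pr pG cov; case: (boolP (cyclic G^`(1))) => [|ncH]; first by left.
right; set H := G^`(1)%G; have sHG : H \subset G := der_sub 1 G.
have pH : p.-group H := pgroupS sHG pG.
have ncHH : ~~ cyclic (H / H^`(1)).
  by apply: contra ncH; apply: cyclic_nilpotent_quo_der1_cyclic; apply: pgroup_nil pH.
set e0 := (p ^ (m.+1 + (m + m)))%N.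
have nsH2 : H^`(1) <| G by apply: char_normal_trans (der_char 1 H) (der_normal 1 G).
have nH2 := normal_norm nsH2; have nH2H := subset_trans sHG nH2.
have derQ : (G / H^`(1))^`(1) = H / H^`(1) by rewrite -quotient_der.
have [lepm expQ] : p <= m /\ forall h, h \in H / H^`(1) -> h ^+ e0 = 1.
  have := @metabelian_exponent _ p m (G / H^`(1))%G p_pr (quotient_pgroup _ pG)
    (comm_cover_quotient nH2 cov).
  rewrite /= derQ => /(_ ncHH); apply.
  exact: sub_der1_abelian.
have expH h : h \in H -> h ^+ e0 \in H^`(1).
  move=> Hh; have Nh := subsetP nH2H h Hh; apply: coset_idr; first exact: groupX.
  by rewrite (morphX _ _ Nh) /= expQ // mem_quotient.
have e0_gt0 : 0 < e0 by rewrite expn_gt0 prime_gt0.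
pose G0 := cycles_normalizer G.
have nsG0 : G0 <| G := cycles_normalizer_normal G.
pose H0 := (H :&: G0)%G.
have nsH0 : H0 <| G by rewrite normalI // der_normal.
have leH0 : #|H : H0| <= m ^ m.
  apply: leq_trans (index_cycles_normalizer p_pr pG cov).
  have eI : #|H : H0| = #|H : G0| by rewrite /H0 /= indexgI.
  by rewrite eI subset_leq_card // imsetS.
pose D := H0^`(1)%G.
have nsD : D <| G by apply: char_normal_trans (der_char 1 H0) nsH0.
have sDH : D \subset H by apply: subset_trans (der_sub 1 H0) (subsetIl _ _).
have nDG := normal_norm nsD; have nDH := subset_trans sHG nDG.
have derD : (G / D)^`(1) = H / D by rewrite -quotient_der.
have der2D : (G / D)^`(2) = H^`(1) / D by rewrite -quotient_der.
set n0 := #|H : H0| in leH0 *.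
set e1 := (e0 * n0 * (m`! * n0))%N.
have n0_gt0 : 0 < n0 by rewrite indexg_gt0.
have e1_gt0 : 0 < e1 by rewrite !muln_gt0 e0_gt0 n0_gt0 fact_gt0.
have leHD : #|H : D| <= card_bound m e1.
  rewrite -card_quotient // -derD; apply: card_der1_bound => //.
    exact: comm_cover_quotient.
  have idx : #|(G / D)^`(1) : H0 / D| = n0.
    rewrite derD index_quotient_eq //; last exact: subsetIl.
    exact: subset_trans (subsetIr _ _) (der_sub 1 H0).
  rewrite /e1 -idx; apply: exponent_step.
  - exact: comm_cover_quotient.
  - exact: quotient_normal.
  - exact: sub_der1_abelian.
  - by rewrite derD quotientS // subsetIl.
  move=> h; rewrite derD der2D => /morphimP[z Nz Hz ->].
  by rewrite -(morphX _ _ Nz) /= mem_quotient // expH.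
have sDZ : D \subset 'Z(H).
  rewrite subsetI sDH; apply: subset_trans (cycles_normalizer_der1_cent G).
  exact: dergS (subsetIr _ _).
have expH2 h : h \in H -> h ^+ (e0 * #|H : D|) = 1.
  by move=> Hh; rewrite expgM; apply: der1_expg_index_center sDZ (expH h Hh).
have leH := card_der1_bound _ cov expH2.
apply: leq_trans (leH _) _; first by rewrite muln_gt0 e0_gt0 indexg_gt0.
(* Through [p <= m] the bound becomes independent of p. *)
have le0 : e0 <= m ^ (m.+1 + (m + m)) by rewrite leq_exp2r.
apply: card_bound_mono => //; first by rewrite muln_gt0 e0_gt0 indexg_gt0.
apply: leq_mul => //; apply: leq_trans leHD _; apply: card_bound_mono => //.
by rewrite /e1 !leq_mul.
Qed.

From mathcomp Require Import boolp classical_sets functions cardinality.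
From mathcomp Require Import topology.

Local Open Scope classical_set_scope.
Local Open Scope card_scope.
Local Open Scope group_scope.

(** * Profinite groups *)

Section CompactTotallyDisconnected.
Variable T : topologicalType.
Hypotheses (cptT : compact [set: T]) (hsT : hausdorff_space T).

Definition quasi_component (x : T) :=
  \bigcap_(C in [set C : set T | clopen C /\ C x]) C.

(** Each point outside W is missed by some clopen neighbourhood of x; by compactness of the
    complement of W, one such neighbourhood misses all of it. *)
Lemma quasi_component_clopen (x : T) (W : set T) : open W ->
  quasi_component x `<=` W -> exists2 C : set T, clopen C /\ C x & C `<=` W.
Proof.
move=> oW QW; pose F := filter_from [set C : set T | clopen C /\ C x] id.
have FF : Filter F.
  apply: filter_from_filter; first by exists setT; split=> //; exact: clopenT.
  by move=> A B [? ?] [? ?]; exists (A `&` B) => //; split=> //; exact: clopenI.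
have PF : ProperFilter F by apply: filter_from_proper => C [_ Cx]; exists x.
have /(iffLR (compact_near_coveringP _)) : compact (~` W).
  by apply: (subclosed_compact _ cptT) => //; exact: open_closedC.
move=> /(_ _ _ setC (powerset_filter_from_filter PF))[].
  move=> y nWy; have [C [[oC cC] Cx] nCy] : exists2 C, clopen C /\ C x & ~ C y.
    apply: contrapT => nex; apply: nWy; apply: QW => C CP.
    by apply: contrapT => nCy; apply: nex; exists C.
  exists (~` C, [set U | U `<=` C]); first split.
  - by apply: open_nbhs_nbhs; split => //; exact: closed_openC.
  - apply/near_powerset_filter_fromP; first by move=> ? ?; exact: subset_trans.
    by exists C => //; exists C.
  - by case=> i j [? /subsetC]; apply.
move=> D [DF _ [C DC]] /(_ _ DC)/subsetC2 CW.
have [B [clB Bx] BC] := DF _ DC.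
by exists B => //; apply: subset_trans CW.
Qed.

Lemma quasi_component_closed x : closed (quasi_component x).
Proof. by apply: closed_bigI => C [[]]. Qed.

Lemma quasi_component_self x : quasi_component x x.
Proof. by move=> C []. Qed.

Lemma quasi_component_connected x : connected (quasi_component x).
Proof.
set Q := quasi_component x.
have half (A B : set T) : closed A -> closed B -> A `&` B = set0 ->
    Q = A `|` B -> A x -> B = set0.
  move=> cA cB AB0 QAB Ax.
  have [|C /set_nbhsP[O [oO AO OC]] clC] := @compact_normal T hsT cptT A cA (~` B).
    apply/set_nbhsP; exists (~` B); split=> //; first exact: closed_openC.
    by move=> a Aa Ba; have : (A `&` B) a by []; rewrite AB0.
  have [|q Qq|D [[oD cD] Dx] DW] := @quasi_component_clopen x (O `|` ~` closure C).
  - by apply: openU => //; apply: closed_openC; apply: closed_closure.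
  - have : (A `|` B) q by rewrite -QAB.
    by case=> [/AO|Bq]; [left | right => /clC].
  (* The open set [D & O] is also the intersection of D with the closure of C, hence closed: it is
     one of the clopen sets whose intersection is Q. *)
  have EQ : Q `<=` D `&` O.
    move=> q; apply; split; last by split=> //; exact: AO.
    split; first exact: openI.
    have -> : D `&` O = D `&` closure C; last by apply: closedI => //; apply: closed_closure.
    apply/seteqP; split=> z [Dz Oz]; split=> //; first by apply: subset_closure; apply: OC.
    by case: (DW z Dz).
  apply/seteqP; split=> // b Bb; have [_ /OC Cb] : (D `&` O) b by apply: EQ; rewrite QAB; right.
  by apply: (clC b) => //; apply: subset_closure.
have cQ : closed Q := @quasi_component_closed x.
move=> B [b Bb] [O oO BO] [F cF BF].
have cB : closed B by rewrite BF; apply: closedI.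
have cR : closed (Q `&` ~` O) by apply: closedI => //; apply: open_closedC.
have BR0 : B `&` (Q `&` ~` O) = set0.
  by apply/seteqP; split=> // z; rewrite BO => -[[_ Oz] [_ /(_ Oz)]].
have QBR : Q = B `|` (Q `&` ~` O).
  apply/seteqP; split=> [z Qz | z [|[]//]]; last by rewrite BO => -[].
  by have [Oz|nOz] := pselect (O z); [left; rewrite BO | right].
have Qx : Q x := @quasi_component_self x.
have [Ox|nOx] := pselect (O x).
  have R0 : Q `&` ~` O = set0 by apply: half cB cR BR0 QBR _; rewrite BO.
  by rewrite [RHS]QBR R0 setU0.
have B0 : B = set0.
  apply: (half (Q `&` ~` O) B cR cB); [by rewrite setIC|by rewrite setUC|].
  by split.
by move: Bb; rewrite B0.
Qed.

Lemma totally_disconnected_clopen x (U : set T) :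
  totally_disconnected [set: T] -> open U -> U x ->
  exists2 C : set T, clopen C /\ C x & C `<=` U.
Proof.
move=> td oU Ux; apply: quasi_component_clopen => // y Qy.
have : connected_component [set: T] x y.
  exists (quasi_component x) => //; split=> //; first exact: quasi_component_self.
  exact: quasi_component_connected.
by rewrite td // => ->.
Qed.

End CompactTotallyDisconnected.

(** The group law is put on the ordinals that number the classes, so that the quotient is a
    [finGroupType] and the finite results apply to it. *)
Lemma finite_quotient_group (G : groupType) n (f : 'I_n -> G) (g : G -> 'I_n) :
  cancel f g -> (forall x x' y y', g x = g x' -> g y = g y' -> g (x * y) = g (x' * y')) ->
  exists (gT : finGroupType) (h : UMagmaMorphism.type G gT),
  [/\ #|gT| = n, forall x y, h x = h y <-> g x = g y & forall z, exists x, h x = z].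
Proof.
move=> fK gM.
pose mul i j := g (f i * f j); pose one := g 1; pose inv i := g (f i)^-1.
have gf x : g (f (g x)) = g x by rewrite fK.
have mulA : associative mul.
  move=> i j k; rewrite /mul -[RHS](gM (f i * f j) _ (f k)) // -mulgA.
  by apply: gM => //; rewrite gf.
have mul1 : left_id one mul.
  by move=> i; rewrite /mul /one (gM _ 1 _ (f i)) ?mul1g.
have mulV : left_inverse one inv mul.
  by move=> i; rewrite /mul /inv (gM _ (f i)^-1 _ (f i)) ?mulVg.
pose gT : finGroupType := HB.pack 'I_n (Finite_isGroup.Build 'I_n mulA mul1 mulV).
pose h : G -> gT := g.
have hM : {morph h : x y / x * y} by move=> x y; apply: gM; rewrite gf.
pose hh : UMagmaMorphism.type G gT :=
  HB.pack h (isUMagmaMorphism.Build G gT h (erefl, hM)).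
exists gT, hh; split=> //; first exact: card_ord.
by move=> z; exists (f z); exact: fK.
Qed.

(** * Open normal subgroups and finite quotients *)

Section TopologicalGroups.
Variable G : topologicalGroupType.
Implicit Types (N S V U : set G) (x y : G).

Lemma group_closed_set S : group_closed [in S] <->
  S 1 /\ (forall x y, S x -> S y -> S (x * y^-1)).
Proof.
split=> [[/set_mem S1 Sd]|[S1 Sd]]; split=> //.
- by move=> x y /mem_set Sx /mem_set Sy; apply/set_mem/Sd.
- exact: mem_set.
- by move=> x y /set_mem Sx /set_mem Sy; apply/mem_set/Sd.
Qed.

Lemma subgroupV S x : group_closed [in S] -> S x -> S x^-1.
Proof. by move=> /group_closed_set[S1 SB] Sx; rewrite -[x^-1]mul1g; apply: SB. Qed.

Lemma subgroupM S x y : group_closed [in S] -> S x -> S y -> S (x * y).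
Proof.
move=> gS Sx Sy; have /group_closed_set[_ SB] := gS.
by rewrite -[y]invgK; apply: SB => //; exact: subgroupV.
Qed.

Lemma subgroupMl S x y : group_closed [in S] -> S x -> S (x * y) -> S y.
Proof. by move=> gS Sx Sxy; rewrite -(mulKg x y); apply: subgroupM => //; apply: subgroupV. Qed.

Lemma subgroupX S x n : group_closed [in S] -> S x -> S (x ^+ n).
Proof.
move=> gS Sx; elim: n => [|n IHn]; first by have /group_closed_set[] := gS.
by rewrite expgS; apply: subgroupM.
Qed.

Lemma cvgM T (F : set_system T) {FF : Filter F} (u v : T -> G) x y :
  u @ F --> x -> v @ F --> y -> (fun t => u t * v t) @ F --> x * y.
Proof. by apply: continuous2_cvg; exact: (@mulg_continuous G (x, y)). Qed.

Lemma mulgl_continuous (a : G) : continuous (fun x : G => a * x).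
Proof. by move=> x; apply: cvgM; [exact: cvg_cst | exact: cvg_id]. Qed.

Lemma open_lcoset S x : open S -> open [set y | S (x * y)].
Proof. by move=> oS; apply: open_comp => // z _; apply: mulgl_continuous. Qed.

Lemma subgroup_open S V : group_closed [in S] -> nbhs 1 V -> V `<=` S -> open S.
Proof.
move=> gS V1 VS; rewrite openE => x Sx /=; rewrite /interior.
have : nbhs x [set y | V (x^-1 * y)].
  by apply: (@mulgl_continuous x^-1 x); rewrite mulVg.
apply: filterS => y /= /VS; exact: (subgroupMl gS (subgroupV gS Sx)).
Qed.

(** N consists of the elements whose insertion into any product never affects membership in V, which
    makes it a normal subgroup. As V is clopen, all n close to 1 qualify near a given pair (a, b),
    and compactness of the square of G makes this uniform. *)
Lemma open_normal_sub (V : set G) : compact [set: G] -> clopen V -> V 1 ->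
  exists2 N, normal_subgroup N /\ open N & N `<=` V.
Proof.
move=> cptG [oV cV] V1.
pose N := [set n : G | forall a b, V (a * b) <-> V (a * n * b)].
have gN : group_closed [in N].
  apply/group_closed_set; split=> [a b|x y Nx Ny a b]; first by rewrite mulg1.
  by rewrite mulgA (Ny (a * x * y^-1) b) mulgKV; exact: Nx.
have nN x y : N y -> N (y ^ x).
  move=> Ny a b; rewrite conjgE !mulgA -!(mulgA _ x b) -(Ny (a * x^-1) (x * b)).
  by rewrite !mulgA mulgKV.
exists N; last by move=> n /(_ 1 1); rewrite !mul1g mulg1 => -[VV _]; apply: VV.
split=> //.
have cptGG : compact [set: G * G] by rewrite -setXTT; exact: compact_setX.
have nearV := (iffLR (compact_near_coveringP _) cptGG G (nbhs (1 : G))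
  (fun n ab => V (ab.1 * ab.2) <-> V (ab.1 * n * ab.2)) (nbhs_filter 1)).
have N1 : nbhs 1 [set n | [set: G * G] `<=` [set ab | V (ab.1 * ab.2) <-> V (ab.1 * n * ab.2)]].
  apply: nearV => -[a b] _; have clopen_near C : open C -> C (a * b) ->
      \forall ab \near (a, b) & n \near (1 : G), C (ab.1 * ab.2) /\ C (ab.1 * n * ab.2).
    move=> oC Cab; have Cn : nbhs (a * b) C by exact: open_nbhs_nbhs.
    have cv1 : (fun z : (G * G) * G => z.1) @ (nbhs (a, b), nbhs 1) --> (a, b) by exact: cvg_fst.
    have ca : (fun z : (G * G) * G => z.1.1) @ (nbhs (a, b), nbhs 1) --> a.
      by apply: (cvg_comp _ _ cv1); exact: cvg_fst.
    have cb : (fun z : (G * G) * G => z.1.2) @ (nbhs (a, b), nbhs 1) --> b.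
      by apply: (cvg_comp _ _ cv1); exact: cvg_snd.
    have cn : (fun z : (G * G) * G => z.2) @ (nbhs (a, b), nbhs 1) --> (1 : G) by exact: cvg_snd.
    apply: filterI; first exact: (cvgM ca cb Cn).
    have Cn1 : nbhs (a * 1 * b) C by rewrite mulg1.
    exact: (cvgM (cvgM ca cn) cb Cn1).
  have [Vab|nVab] := pselect (V (a * b)).
    by apply: filterS (clopen_near V oV Vab) => z [].
  by apply: filterS (clopen_near (~` V) (closed_openC cV) nVab) => z [].
by apply: (subgroup_open gN N1) => n /= Vn a b; exact: (Vn (a, b)).
Qed.

Lemma eq_lcoset N x y : group_closed [in N] ->
  [set x * n | n in N] = [set y * n | n in N] <-> N (x^-1 * y).
Proof.
move=> gN; have /group_closed_set[N1 _] := gN; split=> [exy|Nxy].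
  have : [set x * n | n in N] y by rewrite exy; exists 1; rewrite ?mulg1.
  by case=> n Nn <-; rewrite mulKg.
apply/seteqP; split=> _ [n Nn <-].
  exists (y^-1 * x * n); last by rewrite !mulgA mulgV mul1g.
  by apply: subgroupM => //; rewrite -[x]invgK -invgM; apply: subgroupV.
exists (x^-1 * y * n); last by rewrite !mulgA mulgV mul1g.
by apply: subgroupM.
Qed.

Lemma pro_p_quotient p N : prime p -> pro_p p G -> normal_subgroup N -> open N ->
  exists (gT : finGroupType) (h : UMagmaMorphism.type G gT),
  [/\ p.-group [set: gT]%SET, forall x, h x = 1 <-> N x & forall z, exists x, h x = z].
Proof.
move=> p_pr [_ card_p] nN oN; have [k] := card_p N nN oN.
have [gN NJ] := nN.
move/card_set_bijP=> [f [fn fI fS]].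
pose C x : set G := [set x * n | n in N].
have fP x : (f (C x) < p ^ k)%N by apply: fn; exists x.
pose g x := Ordinal (fP x).
have gE x y : g x = g y <-> N (x^-1 * y).
  rewrite -eq_lcoset //; split=> [[]|exy]; last by apply/val_inj => /=; congr f.
  by apply: fI; rewrite inE; [exists x | exists y].
have /choice[r rP] : forall i, exists x, g x = i.
  move=> i; have [|_ [x _ <-] fi] := fS i; first exact: ltn_ord.
  by exists x; apply/val_inj.
have [|gT [h [cT hE hS]]] := finite_quotient_group rP.
  move=> x x' y y' /gE Nx /gE Ny; apply/gE.
  have -> : (x * y)^-1 * (x' * y') = (x^-1 * x') ^ y * (y^-1 * y').
    by rewrite conjgE invgM !mulgA mulgK.
  by apply: subgroupM => //; apply: NJ.
exists gT, h; split=> //.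
  by rewrite /pgroup cardsT cT pnatX pnat_id.
have h1 : h 1 = 1 := gmulf1.
move=> x; rewrite -h1; split=> [/esym|Nx]; first by rewrite hE gE invg1 mul1g.
by apply/esym; rewrite hE gE invg1 mul1g.
Qed.

End TopologicalGroups.

(** * Derived subgroups and coverings in finite quotients *)

Section ClosedSubgroups.
Variable G : topologicalGroupType.
Implicit Types (N S A : set G) (x y : G).

Lemma closed_gen_sub S A : closed_subgroup S -> A `<=` S -> closed_gen A `<=` S.
Proof. by move=> cS AS; apply: smallest_sub. Qed.

Lemma sub_closed_gen A : A `<=` closed_gen A.
Proof. exact: sub_smallest. Qed.

Lemma closed_gen_subgroup A : closed_subgroup (closed_gen A).
Proof.
split; last by apply: closed_bigI => S [[]].
apply/group_closed_set; split=> [S [[/group_closed_set[S1 _] _] _] //|x y Ax Ay S [cS AS]].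
have [/group_closed_set[_ SB] _] := cS.
by apply: SB; [apply: Ax | apply: Ay].
Qed.

Section Quotient.
Variables (N : set G) (gT : finGroupType) (h : UMagmaMorphism.type G gT).
Hypotheses (oN : open N) (hN : forall x, h x = 1 <-> N x).
Hypothesis (hS : forall z, exists x, h x = z).

Lemma quotient_preimage_open (A : set gT) : open (h @^-1` A).
Proof.
rewrite openE => x Ax; apply: (@filterS _ _ _ [set y | N (x^-1 * y)]).
  by move=> y /hN /eqP; rewrite gmulfM gmulfV -eq_mulVg1 => /eqP hxy; rewrite /preimage /= -hxy.
apply: open_nbhs_nbhs; split; first exact: open_lcoset.
by rewrite /= mulVg; apply/hN; exact: gmulf1.
Qed.

Lemma quotient_preimage_subgroup (H : {group gT}) :
  closed_subgroup (h @^-1` [set` H]).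
Proof.
split; last by rewrite -openC; exact: quotient_preimage_open (~` _).
apply/group_closed_set; split=> [|x y] /=; first by rewrite gmulf1 group1.
by move=> Hx Hy; rewrite gmulfM gmulfV groupM ?groupV.
Qed.

Lemma quotient_closed_gen A (H : {group gT}) :
  (forall x, A x -> h x \in H) -> forall x, closed_gen A x -> h x \in H.
Proof. by move=> AH; apply: closed_gen_sub => //; exact: quotient_preimage_subgroup. Qed.

Lemma quotient_derived x : derived_subgroup G x -> h x \in [set: gT]%G^`(1).
Proof.
apply: quotient_closed_gen => _ [y [z ->]].
by rewrite gmulfR mem_commg ?inE.
Qed.

Lemma quotient_derived_surj z : z \in [set: gT]%G^`(1) ->
  exists2 x, derived_subgroup G x & h x = z.
Proof.
have [gD _] := closed_gen_subgroup [set g : G | exists x y, g = [~ x, y]].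
pose I := [set z | `[< exists2 x, derived_subgroup G x & h x = z >]]%SET.
have gI : group_set I.
  apply/group_setP; split=> [|u v]; rewrite !inE.
    by exists 1; [have /group_closed_set[] := gD | exact: gmulf1].
  move=> [x Dx <-] [y Dy <-].
  by exists (x * y); [exact: (subgroupM gD Dx Dy) | rewrite gmulfM].
have sI : [set: gT]%G^`(1) \subset Group gI.
  rewrite gen_subG; apply/fintype.subsetP => _ /imset2P[u v _ _ ->].
  have [[x <-] [y <-]] := (hS u, hS v); rewrite inE; apply/asboolP.
  by exists [~ x, y]; [apply: sub_closed_gen; exists x, y | rewrite gmulfR].
by move=> /(fintype.subsetP sI); rewrite inE => /asboolP.
Qed.

Lemma quotient_comm_cover m (C : 'I_m -> set G) :
  (forall i, procyclic_subgroup (C i)) ->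
  (forall x y : G, (\bigcup_i C i) [~ x, y]) -> comm_cover m [set: gT]%G.
Proof.
move=> /choice[s Cs] Cxy; exists (h \o s) => u v _ _.
have [[x <-] [y <-]] := (hS u, hS v).
have [i _] := Cxy x y; rewrite Cs => /quotient_closed_gen xy_i.
exists i; rewrite -gmulfR; apply: (xy_i <[h (s i)]>%G) => _ ->; exact: cycle_id.
Qed.

End Quotient.
End ClosedSubgroups.

Lemma card_le_or_II T (A : set T) n :
  (exists2 k, (k <= n)%N & A #= `I_k) \/ `I_n.+1 #<= A.
Proof.
have [finA|/infiniteP natA] := pselect (finite_set A); last first.
  by right; apply: card_le_trans natA; exact: subset_card_le.
have [k Ak] := (iffLR (finite_setP _) finA).
have [le_kn|lt_nk] := leqP k n; [by left; exists k | right].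
by rewrite (card_le_eqr Ak) card_le_II.
Qed.

Lemma p_elt_expg_fix p (gT : finGroupType) (x : gT) k :
  prime p -> p.-elt x -> p %| k -> x = x ^+ k -> x = 1.
Proof.
move=> p_pr /p_natP[[|n] ox] /dvdnP[q ->] xk; first by apply/eqP; rewrite -order_eq1 ox.
suff : x ^+ (p ^ n) = 1 by move/eqP; rewrite -order_dvdn ox dvdn_Pexp2l ?prime_gt1 // ltnn.
by rewrite xk -expgM -mulnA -expnS mulnC expgM -ox expg_order expg1n.
Qed.

(** * From finite quotients back to the pro-p group *)

Section ProP.
Variables (G : topologicalGroupType) (p : nat).
Hypotheses (p_pr : prime p) (pG : pro_p p G).
Implicit Types (N S A U : set G) (x y : G).

Lemma open_normal_base U : open U -> U 1 ->
  exists2 N, normal_subgroup N /\ open N & N `<=` U.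
Proof.
have [[cptG hsG tdG] _] := pG => oU U1.
have [V [clV V1] VU] := totally_disconnected_clopen cptG hsG tdG oU U1.
have [N ? NV] := open_normal_sub cptG clV V1; exists N => //.
exact: subset_trans VU.
Qed.

Lemma quotient_refine N N0 (gT gT0 : finGroupType)
    (h : UMagmaMorphism.type G gT) (h0 : UMagmaMorphism.type G gT0) :
  N `<=` N0 -> (forall x, h x = 1 <-> N x) -> (forall x, h0 x = 1 <-> N0 x) ->
  forall x y, h x = h y -> h0 x = h0 y.
Proof.
move=> NN0 hN h0N x y hxy; apply/eqP; rewrite eq_mulVg1 -gmulfV -gmulfM.
apply/eqP/h0N/NN0/hN.
by rewrite gmulfM gmulfV hxy mulVg.
Qed.

Lemma quotient_separates N (gT : finGroupType) (h : UMagmaMorphism.type G gT)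
    n (e : 'I_n -> G) :
  (forall x, h x = 1 <-> N x) -> (forall i, derived_subgroup G (e i)) ->
  (forall i j, i != j -> ~ N ((e i)^-1 * e j)) -> open N -> n <= #|[set: gT]%G^`(1)|.
Proof.
move=> hN De eN oN.
have he : injective (h \o e).
  move=> i j /= hij; apply/eqP/negP => /negP/eN; apply; apply/hN.
  by rewrite gmulfM gmulfV hij mulVg.
rewrite -[n in n <= _]card_ord -(card_imset _ he) subset_leq_card //.
apply/fintype.subsetP => _ /imsetP[i _ ->]; exact: (quotient_derived oN hN).
Qed.

Lemma card_le_II_inj n A : `I_n #<= A ->
  exists2 e : 'I_n -> G, injective e & forall i, A (e i).
Proof.
rewrite (card_le_eql (card_II (n := n))) => /card_leP[f].
exists (fun i => val (f (to_setT i))) => [i j|i]; last exact: set_valP.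
by move=> /val_inj/inj; rewrite !inE => /(_ I I) [].
Qed.

(* Finitely many points of the derived subgroup remain distinct modulo a small
   enough open normal subgroup. *)
Lemma derived_card_bound N0 b : open N0 -> N0 1 ->
  (forall N (gT : finGroupType) (h : UMagmaMorphism.type G gT),
     open N -> N `<=` N0 -> (forall x, h x = 1 <-> N x) ->
     (forall z, exists x, h x = z) -> p.-group [set: gT]%G ->
     #|[set: gT]%G^`(1)| <= b) ->
  exists2 n, (n <= b)%N & derived_subgroup G #= `I_n.
Proof.
move=> oN0 N01 Hb; have [//|/card_le_II_inj[e eI eD]] := card_le_or_II (derived_subgroup G) b.
pose A : set G := (fun ij : 'I_b.+1 * 'I_b.+1 => (e ij.1)^-1 * e ij.2) @` [set ij | ij.1 != ij.2].
have cA : closed A.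
  have [[_ hsG _] _] := pG.
  apply: (iffLR accessible_finite_set_closed (hausdorff_accessible hsG)).
  exact: finite_image (@finite_finset ('I_b.+1 * 'I_b.+1)%type _).
have [||N [nN oN] NU] := @open_normal_base (N0 `&` ~` A).
- by apply: openI => //; exact: closed_openC.
- split=> // -[[i j] /= /negP + eij]; apply.
  by apply/eqP/eI; rewrite -(mulKVg (e i) (e j)) eij mulg1.
have [gT [h [pgT hN hS]]] := pro_p_quotient p_pr pG nN oN.
suff : b < #|[set: gT]%G^`(1)|.
  by rewrite ltnNge (Hb N gT h) // => x /NU[].
apply: (quotient_separates hN eD) => // i j ij /NU[_]; apply.
by exists (i, j).
Qed.

Lemma derived_procyclic :
  (forall N (gT : finGroupType) (h : UMagmaMorphism.type G gT),
     open N -> (forall x, h x = 1 <-> N x) ->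
     (forall z, exists x, h x = z) -> p.-group [set: gT]%G ->
     cyclic [set: gT]%G^`(1)) ->
  procyclic_subgroup (derived_subgroup G).
Proof.
set D := derived_subgroup G => Hc.
have [gD cD] : closed_subgroup D := closed_gen_subgroup _.
have [D1|] := pselect (D `<=` [set 1]).
  exists 1; apply/seteqP; split=> [x /D1 ->|]; first exact: sub_closed_gen.
  by apply: closed_gen_sub => // _ ->; have /group_closed_set[] := gD.
move=> /existsNP[d0 /not_implyP[Dd0 d0_1]].
have [[_ hsG _] _] := pG.
have [||N0 [nN0 oN0] N0d0] := @open_normal_base (~` [set d0]).
- by apply/closed_openC/accessible_closed_set1/hausdorff_accessible.
- by move=> /esym.
have [gT0 [h0 [pgT0 h0N h0S]]] := pro_p_quotient p_pr pG nN0 oN0.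
have /cyclicP[z0 defD0] := Hc N0 gT0 h0 oN0 h0N h0S pgT0.
have [x Dx h0x] : exists2 x, D x & h0 x = z0.
  by apply: (quotient_derived_surj h0S); rewrite defD0 cycle_id.
have h0x1 : h0 x <> 1.
  move=> h0x1; have := quotient_derived oN0 h0N Dd0.
  rewrite defD0 -h0x h0x1 cycle1 inE => /eqP/h0N/N0d0; exact.
exists x; apply/seteqP; split; last first.
  by apply: closed_gen_sub => // _ ->.
move=> d Dd; apply: contrapT => nSd.
have [gS cS] := closed_gen_subgroup [set x].
(* The subgroup generated by x is closed, so for small N the coset d N misses it; a power of x in d
   N will give the contradiction. *)
have [||N [nN oN] NU] := @open_normal_base (N0 `&` [set y | (~` closed_gen [set x]) (d * y)]).
- by apply: openI => //; apply: open_lcoset; exact: closed_openC.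
- by rewrite /= mulg1; split=> //; apply/h0N; exact: gmulf1.
have [gT [h [pgT hN hS]]] := pro_p_quotient p_pr pG nN oN.
have cyc := Hc N gT h oN hN hS pgT.
have hD y : D y -> h y \in [set: gT]%G^`(1) := @quotient_derived _ _ _ _ oN hN y.
have h_h0 := @quotient_refine N N0 _ _ h h0 (fun y Ny => (NU y Ny).1) hN h0N.
(* Otherwise [h x = h d ^+ r] with p dividing r. Modulo N0, where d is a power of x, this reads
   [h0 x = h0 x ^+ (s * r)], which is possible for a p-element only if [h0 x = 1]. *)
have hdx : h d \in <[h x]>.
  have p_elt y : p.-elt (h y) by apply: mem_p_elt pgT _; rewrite inE.
  have [//|/cycleP[r hxr]] := p_elt_cyclic_chain p_pr cyc (hD d Dd) (hD x Dx) (p_elt d) (p_elt x).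
  have [pr|] := boolP (coprime #[h d] r).
    by move: pr; rewrite -generator_coprime -hxr => /eqP <-; exact: cycle_id.
  have [n od] := p_natP (p_elt d); rewrite od => ncop.
  have {ncop} p_r : p %| r.
    by apply: contraR ncop => p_r; apply: coprimeXl; rewrite prime_coprime.
  have [s h0ds] : exists s, h0 d = h0 x ^+ s.
    by apply/cycleP; rewrite h0x -defD0; exact: (quotient_derived oN0 h0N).
  case: h0x1; apply: (p_elt_expg_fix p_pr (k := (s * r)%N)).
  - by apply: mem_p_elt pgT0 _; rewrite inE.
  - exact: dvdn_mull.
  - by rewrite expgM -h0ds -gmulfXn; apply: h_h0; rewrite gmulfXn.
have /cycleP[i hi] := hdx.
have /NU[_ /=] : N (d^-1 * x ^+ i) by apply/hN; rewrite gmulfM gmulfV gmulfXn hi mulVg.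
by rewrite mulKVg; apply; apply: (subgroupX _ gS); exact: sub_closed_gen.
Qed.

End ProP.

Lemma quotient_derived_cyclic (G : topologicalGroupType) (N N0 : set G)
    (gT gT0 : finGroupType)
    (h : UMagmaMorphism.type G gT) (h0 : UMagmaMorphism.type G gT0) :
  open N -> N `<=` N0 -> (forall x, h x = 1 <-> N x) -> (forall x, h0 x = 1 <-> N0 x) ->
  (forall z, exists x, h x = z) -> (forall z, exists x, h0 x = z) ->
  cyclic [set: gT]%G^`(1) -> cyclic [set: gT0]%G^`(1).
Proof.
move=> oN NN0 hN h0N hS h0S /cyclicP[z defD].
have [d _ hd] : exists2 d, derived_subgroup G d & h d = z.
  by apply: (quotient_derived_surj hS); rewrite defD cycle_id.
apply: (cyclicS _ (cycle_cyclic (h0 d))); apply/fintype.subsetP => w.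
move=> /(quotient_derived_surj h0S)[e De <-].
have := quotient_derived oN hN De; rewrite defD -hd => /cycleP[i].
rewrite -gmulfXn => /(quotient_refine NN0 hN h0N) ->.
by rewrite gmulfXn mem_cycle.
Qed.

Theorem theoremB : exists f : nat -> nat,
  forall (m : nat) (p : nat) (G : topologicalGroupType),
    (0 < m)%N -> prime p -> pro_p p G ->
    (exists C : 'I_m -> set G,
      (forall i, procyclic_subgroup (C i)) /\
      (forall x y : G, (\bigcup_i C i) [~ x, y])) ->
    (exists2 n : nat, (n <= f m)%N & derived_subgroup G #= `I_n) \/
    procyclic_subgroup (derived_subgroup G).
Proof.
exists derived_bound => m p G m0 p_pr pG [C [pC CK]].
have [Hc|nHc] := pselect (forall N (gT : finGroupType) (h : UMagmaMorphism.type G gT),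
   open N -> (forall x, h x = 1 <-> N x) -> (forall z, exists x, h x = z) ->
   p.-group [set: gT]%G -> cyclic [set: gT]%G^`(1)).
  by right; exact: derived_procyclic p_pr pG Hc.
left; apply: contrapT => nbound; apply: nHc => N0 gT0 h0 oN0 h0N h0S pgT0.
apply: contrapT => ncyc; apply: nbound.
apply: (derived_card_bound p_pr pG oN0); first by apply/h0N; exact: gmulf1.
move=> N gT h oN NN0 hN hS pgT.
have cov := quotient_comm_cover oN hN hS pC CK.
have [cyc|//] := derived_cyclic_or_bounded m0 p_pr pgT cov.
by case: ncyc; exact: quotient_derived_cyclic oN NN0 hN h0N hS h0S cyc.
Qed.
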